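(* Let $\ell\in\mathbb{Z}_{\ge 0}$. The following conclusions hold for composition operators on $\mathbb{B}_\ell(\mathbb{C}_+)$. (1) If $g(w)=w+w_0$, where $w_0\in\mathbb{C}$ with $\operatorname{Re}w_0\ge 0$, then the operator $C_{g,\max}$ is $\mathcal{C}_a$-symmetric for every $a\in\mathbb{R}$. (2) If $g(w)=\mu w$, where $\mu\in\mathbb{R}_{>0}$, then the operator $C_{g,\max}$ is $\mathcal{C}_\star$-symmetric. (3) If $g(w)=\mu w+w_0$, where $\mu\in\mathbb{R}_{>0}\setminus\{1\}$ and $w_0\in i\mathbb{R}$, then the operator $C_{g,\max}$ is $U_{1,c}\mathcal{C}_\star U_{1,c}^*$-symmetric, where $c=i(1-\mu)^{-1}w_0$.
   Context: $\mathbb{C}_+=\{z\in\mathbb{C}:\operatorname{Re}z>0\}$. For $\ell\in\mathbb{Z}_{\ge0}$, the weighted Bergman space $\mathbb{B}_\ell(\mathbb{C}_+)$ is the Hilbert space of analytic functions $h:\mathbb{C}_+\to\mathbb{C}$ with $\|h\|^2=\frac1\pi\int_{-\infty}^{\infty}\int_0^\infty x^\ell|h(x+iy)|^2\,dx\,dy<\infty$. For an analytic self-map $g$ of $\mathbb{C}_+$, the composition operator $C_{g,\max}$ has domain $\{h\in\mathbb{B}_\ell(\mathbb{C}_+):h\circ g\in\mathbb{B}_\ell(\mathbb{C}_+)\}$ and acts by $C_{g,\max}h=h\circ g$. A conjugation is an anti-linear isometric involution. For a conjugation $\mathcal{C}$, a densely defined linear operator $B$ is called $\mathcal{C}$-symmetric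 (equivalently, $\mathcal{C}$-selfadjoint) if $B=\mathcal{C}B^*\mathcal{C}$. The conjugations used on $\mathbb{B}_\ell(\mathbb{C}_+)$ are: $\mathcal{C}_a h(z)=\overline{h(\overline z+ia)}$ for $a\in\mathbb{R}$; $\mathcal{C}_\star h(z)=\dfrac{1}{z^{\ell+2}}\overline{h\left(\dfrac{1}{\overline z}\right)}$; and $U_{1,c}\mathcal{C}_\star U_{1,c}^*$, where for $c\in\mathbb{R}$, $U_{1,c}$ is the unitary operator $U_{1,c}\xi(z)=\xi(z+ic)$. *)

(* Defs.v *)
From HB Require Import structures.
From mathcomp Require Import all_boot all_order all_algebra.
From mathcomp Require Import complex.
From mathcomp Require Import all_classical all_reals all_analysis.

Set Implicit Arguments.
Unset Strict Implicit.
Unset Printing Implicit Defensive.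

Import Order.TTheory GRing.Theory Num.Theory.
Import numFieldNormedType.Exports.

Local Open Scope classical_set_scope.
Local Open Scope ring_scope.
Local Open Scope complex_scope.

Section HalfPlane.
Variable R : realType.

(* Elements of the function space are functions on this subtype (and not
   functions on R[i]), so that Leibniz equality is equality on the half-plane. *)
Definition halfplane := {z : R[i] | 0 < complex.Re z}.

Definition hfun := halfplane -> R[i].

(* Extension by 0 to R[i]; only the values on the half-plane are ever used. *)
Definition hext (h : hfun) (z : R[i]) : R[i] := oapp h 0 (insub z).

(* The derivative is taken over the scalar field R[i], i.e. it is the complex
   derivative. *)
Definition analytic_hp (h : hfun) : Prop :=
  forall z : R[i], 0 < complex.Re z ->
    derivable (hext h : (R[i])^o -> (R[i])^o) z 1.

Lemma conj_shift_subproof (a : R) (z : halfplane) :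
  0 < complex.Re ((val z)^* + 'i * a%:C).
Proof. by case: z => -[x y] /= x_gt0; rewrite !mul0r mul1r subr0 addr0. Qed.

Definition hp_conj_shift (a : R) (z : halfplane) : halfplane :=
  exist _ ((val z)^* + 'i * a%:C) (conj_shift_subproof a z).

Lemma conj_inv_subproof (z : halfplane) : 0 < complex.Re (1 / (val z)^*).
Proof.
case: z => -[x y] /= x_gt0; rewrite mul1r mul0r subr0.
by rewrite divr_gt0// sqrrN ltr_wpDr ?sqr_ge0// exprn_gt0.
Qed.

Definition hp_conj_inv (z : halfplane) : halfplane :=
  exist _ (1 / (val z)^*) (conj_inv_subproof z).

Lemma shift_subproof (c : R) (z : halfplane) :
  0 < complex.Re (val z + 'i * c%:C).
Proof. by case: z => -[x y] /= x_gt0; rewrite mul0r mul1r subr0 addr0. Qed.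

Definition hp_shift (c : R) (z : halfplane) : halfplane :=
  exist _ (val z + 'i * c%:C) (shift_subproof c z).

End HalfPlane.

Section Bergman.
Variables (R : realType) (l : nat).
Implicit Types h k : hfun R.

(* p = (x, y) stands for the point x + iy. *)
Definition right_half : set (R * R) := [set p | 0 < p.1].

Local Notation area := (@lebesgue_measure R \x @lebesgue_measure R)%E.

Definition bergman_normsq h : \bar R :=
  ((pi^-1 : R)%:E *
   \int[area]_(p in right_half)
      (p.1 ^+ l * Normc.normc (hext h (p.1 +i* p.2)) ^+ 2)%:E)%E.

Definition bergman : set (hfun R) :=
  [set h | analytic_hp h /\ (bergman_normsq h < +oo)%E].

Definition bergman_norm h : R := Num.sqrt (fine (bergman_normsq h)).

(* Linear in the first argument; the complex integral is given by its real
   and imaginary parts. *)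
Definition bergman_dot h k : R[i] :=
  let F (p : R * R) := hext h (p.1 +i* p.2) * (hext k (p.1 +i* p.2))^* in
  (pi^-1 * \int[area]_(p in right_half) (p.1 ^+ l * complex.Re (F p))) +i*
  (pi^-1 * \int[area]_(p in right_half) (p.1 ^+ l * complex.Im (F p))).

(* Operators in the Bergman space, given by their graphs; the value of an
   operator and its domain are both recorded by the graph. *)
Definition operator := set (hfun R * hfun R).

Implicit Types A B C : operator.

Definition dom A : set (hfun R) := [set h | exists k, A (h, k)].

Definition in_bergman A : Prop :=
  forall h k, A (h, k) -> bergman h /\ bergman k.

Definition single_valued A : Prop :=
  forall h k1 k2, A (h, k1) -> A (h, k2) -> k1 = k2.

Definition linear_operator A : Prop :=
  [/\ in_bergman A, single_valued A, A (fun=> 0, fun=> 0) &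
      forall (a : R[i]) h1 k1 h2 k2, A (h1, k1) -> A (h2, k2) ->
        A (fun z => a * h1 z + h2 z, fun z => a * k1 z + k2 z)].

Definition densely_defined A : Prop :=
  forall h, bergman h -> forall e : R, 0 < e ->
    exists2 k, dom A k & bergman_norm (fun z => h z - k z) < e.

(* The product A B of operators: B is applied first. *)
Definition comp_operator A B : operator :=
  [set p | exists2 u, B (p.1, u) & A (u, p.2)].

Definition id_operator : operator := [set p | bergman p.1 /\ p.1 = p.2].

(* (f, f') is in the graph of the adjoint of A iff <A h, f> = <h, f'> for all
   h in the domain of A; this graph is that of an operator when A is densely
   defined. *)
Definition adjoint A : operator :=
  [set p | [/\ bergman p.1, bergman p.2 &
     forall h k, A (h, k) -> bergman_dot k p.1 = bergman_dot h p.2]].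

Definition conjugation C : Prop :=
  [/\ in_bergman C, single_valued C & dom C = bergman] /\
  [/\ forall (a : R[i]) h1 k1 h2 k2, C (h1, k1) -> C (h2, k2) ->
        C (fun z => a * h1 z + h2 z, fun z => a^* * k1 z + k2 z),
      forall h k, C (h, k) -> bergman_norm k = bergman_norm h &
      comp_operator C C = id_operator].

Definition symmetric_wrt C B : Prop :=
  [/\ conjugation C, linear_operator B, densely_defined B &
      B = comp_operator C (comp_operator (adjoint B) C)].

(* The operator acting by F, with domain all h in the Bergman space such that
   F h is again in the Bergman space. *)
Definition maximal_operator (F : hfun R -> hfun R) : operator :=
  [set p | [/\ bergman p.1, bergman p.2 & p.2 = F p.1]].

Definition composition_max (g : halfplane R -> halfplane R) : operator :=
  maximal_operator (fun h => h \o g).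

Definition conj_shift (a : R) : operator :=
  maximal_operator (fun h z => (h (hp_conj_shift a z))^*).

Definition conj_star : operator :=
  maximal_operator (fun h z => 1 / val z ^+ l.+2 * (h (hp_conj_inv z))^*).

Definition translation (c : R) : operator :=
  maximal_operator (fun h z => h (hp_shift c z)).

Definition conj_star_translated (c : R) : operator :=
  comp_operator (translation c)
    (comp_operator conj_star (adjoint (translation c))).

End Bergman.

(* Main.v *)
(* A composition operator and a conjugation occurring here both act by a formula
   on the whole space, so each statement reduces to an identity C G C = F, where
   F is composition with g and G is its adjoint; hence one needs the adjoint of
   composition with an affine map.  For translations along the imaginary axis and
   for dilations it comes from a linear change of variables.  For z |-> z + x0
   with x0 > 0 it is composition with the same map: the integral over y of
   h(x1 + iy) (f(x2 + iy))^* depends only on x1 + x2, because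
   h(z) (f(s - z^* ))^* is analytic in the strip 0 < Re z < s and integrable over
   closed substrips, so that Cauchy's theorem (Goursat's lemma on rectangles) moves
   the line of integration; the horizontal sides of the rectangles vanish along a
   sequence of heights.  The isometry of C_star is the change of variables
   z |-> 1/z^*, carried out in the coordinates (x, y/x), where it only inverts x. *)

Require Import Defs.
From mathcomp Require Import all_boot all_order all_algebra.
From mathcomp Require Import complex.
From mathcomp Require Import all_classical all_reals all_analysis.
From mathcomp Require Import measurable_realfun.
From mathcomp Require Import ring lra.

Set Implicit Arguments.
Unset Strict Implicit.
Unset Printing Implicit Defensive.

Import Order.TTheory GRing.Theory Num.Theory.
Import numFieldNormedType.Exports.

Local Open Scope classical_set_scope.
Local Open Scope ring_scope.
Local Open Scope complex_scope.

(** * Complex differentiability *)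

Section ComplexTopology.
Variable R : realType.
Implicit Types (z w d : R[i]) (f g : (R[i])^o -> (R[i])^o).

(** Every operator that occurs turns out to be defined on the whole Bergman space, so density of the
    domain is trivial, and an adjoint is found by proposing a formula and testing it against the
    inner product. The obstacle is the shift by x0 > 0: a change of variables moves both the domain
    of integration and the weight x^l, so it does not exhibit the adjoint. On a single vertical
    line, however, the weight is a constant, the same one for both inner products, and the problem
    becomes unweighted. No pointwise decay of Bergman functions is established; the heights where
    the horizontal sides vanish are extracted from the finiteness of an area integral. Analyticity
    here is bare complex differentiability, with no continuity of the derivative, hence Goursat
    rather than Green. The exponent l + 2 has a single origin: the area contributes 2 and the weight
    l. A dilation by m produces m^-(l+2), and the inversion produces |z|^(-2(l+2)), the squared
    modulus of the factor in C_star. In the third case -ic is the fixed point of g, and the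
    translation by c carries the dilation centred at 0 to the one centred there. *)

Lemma normr_normc z : `|z| = (Normc.normc z)%:C.
Proof. by []. Qed.

Lemma conjCE z : (z^*)%R = z^*%C.
Proof. by []. Qed.

Lemma normc_ge0 z : 0 <= Normc.normc z.
Proof. by rewrite -ler0c -normr_normc normr_ge0. Qed.

Lemma normc_gt0 z : (0 < Normc.normc z) = (z != 0).
Proof. by rewrite -(@ltcR R 0) -normr_normc normr_gt0. Qed.

Lemma normcJ z : Normc.normc z^* = Normc.normc z.
Proof. by case: z => x y /=; rewrite sqrrN. Qed.

Lemma normc_real (x : R) : Normc.normc x%:C = `|x|.
Proof. by rewrite /= expr0n/= addr0 sqrtr_sqr. Qed.

Lemma normc_Re z : `|complex.Re z| <= Normc.normc z.
Proof. by rewrite -lecR; exact: normc_ge_Re. Qed.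

Lemma normc_Im z : `|complex.Im z| <= Normc.normc z.
Proof.
case: z => x y /=; rewrite -(sqrtr_sqr y) ler_wsqrtr// lerDr sqr_ge0//.
Qed.

Lemma normc_le_ReIm z : Normc.normc z <= `|complex.Re z| + `|complex.Im z|.
Proof.
rewrite [z in leLHS]complexE (le_trans (le_normcD _ _))//.
rewrite normc_real lerD2l Normc.normcM normc_real.
by rewrite /= expr0n/= add0r expr1n sqrtr1 mul1r.
Qed.

Lemma sqr_normc_ReIm z :
  Normc.normc z ^+ 2 = complex.Re z ^+ 2 + complex.Im z ^+ 2.
Proof. by case: z => x y /=; rewrite sqr_sqrtr// addr_ge0 ?sqr_ge0. Qed.

(** The norm of [R[i]] takes values in [R[i]], so radii are complex numbers that happen to be
    positive; this passes to real radii once and for all. *)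
Lemma nbhsCP z (A : set (R[i])^o) :
  nbhs (z : (R[i])^o) A <->
  exists2 e : R, 0 < e & forall w, Normc.normc (w - z) < e -> A w.
Proof.
split=> [/nbhs_ballP[e /= e0 zA]|[e e0 zA]].
  have eR : (complex.Re e)%:C = e by exact/RRe_real/gtr0_real.
  exists (complex.Re e); first by rewrite -(@ltcR R 0) eR.
  move=> w wz; apply: zA; rewrite /ball/= -eR distrC normr_normc.
  by rewrite ltcR.
apply/nbhs_ballP; exists e%:C => /=; first by rewrite ltcR.
move=> w; rewrite /ball/= distrC normr_normc ltcR; exact: zA.
Qed.

(** The quotient-free form, which includes [w = 0]: it survives conjugation and splits directly into
    real and imaginary parts. *)
Lemma derivableCP f z : derivable f z 1 <->
  exists d, forall e : R, 0 < e -> exists2 r : R, 0 < r &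
    forall w, Normc.normc w < r ->
      Normc.normc (f (z + w) - f z - d * w) <= e * Normc.normc w.
Proof.
split=> [/cvg_ex[/= d /cvgrPdist_le fd]|[d fd]].
  exists d => e e0; have {fd} := fd e%:C; rewrite ltcR => /(_ e0).
  move=> /nbhsCP[r r0 fr]; exists r => // w wr.
  have [->|w0] := eqVneq w 0.
    by rewrite mulr0 addr0 !subrr Normc.normc0 mulr0.
  have := fr w; rewrite subr0 => /(_ wr w0).
  rewrite normr_normc lecR /GRing.scale/= mulr1 addrC => h.
  rewrite (_ : _ - _ = - (w * (- (w^-1 * (f (w + z) - f z)) + d))); last first.
    by rewrite [w + z]addrC; field.
  by rewrite normcN Normc.normcM mulrC ler_wpM2r ?normc_ge0.
apply/cvg_ex; exists d; apply/cvgrPdist_le => e e0.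
have eR : (complex.Re e)%:C = e by exact/RRe_real/gtr0_real.
have e0' : 0 < complex.Re e by rewrite -(@ltcR R 0) eR.
have [r r0 fr] := fd _ e0'.
apply/nbhsCP; exists r => // w; rewrite subr0 => wr w0.
have := fr _ wr => h.
rewrite -eR normr_normc lecR /GRing.scale/= mulr1.
rewrite -(@ler_pM2r _ (Normc.normc w)) ?normc_gt0// (le_trans _ h)//.
rewrite -Normc.normcM -normcN le_eqVlt; apply/orP; left; apply/eqP.
by congr Normc.normc; rewrite [w + z]addrC; field.
Qed.

Lemma derivable_continuousC f z : derivable f z 1 ->
  forall e : R, 0 < e -> exists2 r : R, 0 < r &
    forall w, Normc.normc w < r -> Normc.normc (f (z + w) - f z) < e.
Proof.
move=> fz e e0.
have : {for z, continuous f} by exact/differentiable_continuous/derivable1_diffP.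
move=> /cvgrPdist_lt/(_ e%:C); rewrite ltcR => /(_ e0) /nbhsCP[r r0 fr].
exists r => // w wr; have := fr (z + w).
rewrite addrC addKr => /(_ wr); rewrite normr_normc ltcR.
by rewrite -normcN opprB addrC.
Qed.

Lemma derivable_comp1 f g z :
  derivable f z 1 -> derivable g (f z) 1 -> derivable (g \o f : (R[i])^o -> (R[i])^o) z 1.
Proof.
move=> /derivable1_diffP df /derivable1_diffP dg; apply/derivable1_diffP.
exact: (differentiable_comp df dg).
Qed.

(** Conjugation is isometric, so conjugating the increment and the value conjugates the derivative.
    This is Schwarz reflection, the source of analyticity for both conjugations. *)
Lemma derivable_conj f z :
  derivable f z^*%C 1 ->
  derivable ((fun w : R[i] => (f w^*%C)^*%C) : (R[i])^o -> (R[i])^o) z 1.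
Proof.
move=> /derivableCP[d fd]; apply/derivableCP; exists d^*%C => e /fd[r r0 fr].
exists r => // w wr; have := fr w^*%C; rewrite normcJ => /(_ wr).
have conjB (a b c v : R[i]) :
    (a - b - c * v)^*%C = a^*%C - b^*%C - c^*%C * v^*%C.
  by rewrite !rmorphB rmorphM.
by rewrite -[X in X <= _ -> _]normcJ conjB conjcK -rmorphD.
Qed.

End ComplexTopology.

(** * Analytic functions on the half-plane *)

Section Analytic.
Variable R : realType.
Implicit Types (z w d : R[i]) (h k : hfun R).
Local Notation hp := (halfplane R).

Lemma hext_val h (z : hp) : hext h (val z) = h z.
Proof. by rewrite /hext valK. Qed.

Lemma hextE h z (z0 : 0 < complex.Re z) : hext h z = h (exist _ z z0).
Proof. by rewrite -hext_val. Qed.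

Lemma near_halfplane z : 0 < complex.Re z ->
  \forall w \near (z : (R[i])^o), 0 < complex.Re w.
Proof.
move=> z0; apply/nbhsCP; exists (complex.Re z) => // w wz.
have : `|complex.Re (w - z)| < complex.Re z.
  by rewrite (le_lt_trans (normc_Re _)).
by rewrite raddfB/= ltr_norml => /andP[+ _]; rewrite ltrBrDl subrr.
Qed.

(** The half-plane is open and derivability is local, so the extension by 0 in [hext] may be
    replaced by any formula that is right on the half-plane. *)
Lemma analytic_hpP h (f : (R[i])^o -> (R[i])^o) :
  (forall z : hp, h z = f (val z)) ->
  (forall z, 0 < complex.Re z -> derivable f z 1) -> analytic_hp h.
Proof.
move=> hf df z z0; apply: near_eq_derivable (df z z0).
by have := near_halfplane z0; apply: filterS => w w0; rewrite (hextE _ w0) hf.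
Qed.

Lemma analytic_comp h (g : hp -> hp) (f : (R[i])^o -> (R[i])^o) :
  analytic_hp h -> (forall z : hp, val (g z) = f (val z)) ->
  (forall z, 0 < complex.Re z -> derivable f z 1) -> analytic_hp (h \o g).
Proof.
move=> ah gf df; apply: (@analytic_hpP _ (hext h \o f)) => [z|z z0].
  by rewrite /= -gf hext_val.
apply: derivable_comp1; first exact: df.
apply: ah; have := valP (g (exist _ z z0)).
by rewrite gf.
Qed.

Lemma derivable_hext_conj h z : analytic_hp h -> 0 < complex.Re z ->
  derivable ((fun w => (hext h w^*%C)^*%C) : (R[i])^o -> (R[i])^o) z 1.
Proof.
move=> ah z0; apply: (@derivable_conj _ (hext h : (R[i])^o -> (R[i])^o)).
by apply: ah; case: z z0.
Qed.

Lemma analytic_lin (a : R[i]) h k : analytic_hp h -> analytic_hp k ->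
  analytic_hp (fun z : hp => a * h z + k z).
Proof.
move=> ah ak.
apply: (@analytic_hpP _ ((cst (a : (R[i])^o) * (hext h : (R[i])^o -> (R[i])^o))
  + (hext k : (R[i])^o -> (R[i])^o)))=> [z|z z0].
  by rewrite !fctE !hext_val.
by apply: derivableD; [apply: derivableM => //; exact: ah|exact: ak].
Qed.

Lemma analytic0 : analytic_hp (fun _ : hp => 0 : R[i]).
Proof.
by apply: (@analytic_hpP _ (cst (0 : (R[i])^o))) => // z _; exact: derivable_cst.
Qed.

End Analytic.

(** * Affine changes of variables in the plane *)

Section PlaneMeasure.
Variable R : realType.
Local Notation T := (measurableTypeR R).
Local Notation mu := (@lebesgue_measure R).
Local Notation area := (@lebesgue_measure R \x @lebesgue_measure R)%E.

(** Links the topology of the plane to the product sigma-algebra: an open set is a countable union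
    of boxes with rational corners. *)
Lemma open_measurable2 (A : set (R * R)) :
  open A -> measurable (A : set (T * T)).
Proof.
rewrite openE => oA.
pose box (q : rat * rat * (rat * rat)) : set (T * T) :=
  `](ratr q.1.1 : R), ratr q.1.2[%classic `*` `](ratr q.2.1 : R), ratr q.2.2[%classic.
(* Boxes not contained in [A] are replaced by the empty set, so that the union runs over all
   rational quadruples. *)
pose F q := if pselect (box q `<=` A) then box q else set0.
rewrite (_ : (A : set (T * T)) = \bigcup_q F q).
  apply: countable_bigcupT_measurable => // q; rewrite /F; case: pselect => //= _.
  by apply: measurableX; exact: measurable_itv.
apply/seteqP; split=> [[x y] Axy|p [q _]]; last first.
  by rewrite /F; case: pselect => //= qA; apply: qA.
have [[U V] /= [nU nV] UV] := oA _ Axy.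
have sep (z : R) (W : set R) : nbhs z W -> exists q1 q2 : rat,
    (`](ratr q1 : R), ratr q2[%classic : set R) z /\
    `](ratr q1 : R), ratr q2[%classic `<=` W.
  move=> /nbhs_ballP[e /= e0 eW].
  have [q1] : exists q : rat, ratr q \in `]z - e, z[.
    by apply: rat_in_itvoo; rewrite ltrBlDr ltrDl.
  have [q2] : exists q : rat, ratr q \in `]z, z + e[.
    by apply: rat_in_itvoo; rewrite ltrDl.
  rewrite !in_itv/= => /andP[zq2 q2e] /andP[q1e q1z]; exists q1, q2; split.
    by rewrite /= in_itv/= q1z.
  move=> w; rewrite /= in_itv/= => /andP[q1w wq2]; apply: eW.
  by rewrite /ball/= ltr_distlC; lra.
have [q1 [q2 [xq qU]]] := sep _ _ nU; have [q3 [q4 [yq qV]]] := sep _ _ nV.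
exists ((q1, q2), (q3, q4)) => //; rewrite /F; case: pselect => // H; exfalso.
by apply: H => -[u v] [/= uq vq]; apply: UV; split=> /=; [exact: qU|exact: qV].
Qed.

Lemma continuous_measurable2 (D : set (R * R)) (F : R * R -> R) : open D ->
  (forall p, D p -> {for p, continuous F}) ->
  measurable_fun (D : set (T * T)) (F : T * T -> R).
Proof.
move=> oD cF.
apply: (measurability _ (RGenOInfty.measurableE R)).
move=> /= _ [_ [a ->]] <-; apply: open_measurable2.
rewrite openE => p [Dp /= Fp].
apply: filterI; first by move: oD; rewrite openE; apply.
by apply: (cF p Dp); apply: open_nbhs_nbhs; split.
Qed.

(** By uniqueness of Lebesgue measure it is enough to test intervals []p, q]]. A negative slope
    turns them into intervals closed on the left, of the expected length. *)
Lemma lebesgue_measure_affine (a b : R) (A : set T) : a != 0 -> measurable A ->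
  mu A = (`|a|%:E * mu ((fun x : R => a * x + b)%R @^-1` A))%E.
Proof.
move=> a0 mA; pose phi : T -> T := fun x : R => a * x + b.
have mphi : measurable_fun setT phi.
  by apply: measurable_funD => //; exact: measurable_funM.
pose nu := mscale (NngNum (normr_ge0 a))
  (measure_function_pushforward__canonical__measure_function_Measure mu mphi).
rewrite -[RHS]/(nu A); apply: lebesgue_measure_unique => //= _ [[p q]] _ <-.
rewrite /nu /mscale/= /pushforward.
have [ap|an] := ltP 0 a.
  have -> : phi @^-1` `]p, q] = `](p - b) / a, (q - b) / a]%classic.
    apply/seteqP; split=> x /=; rewrite !in_itv/= /phi;
      by rewrite ltr_pdivrMr// ler_pdivlMr// ltrBlDr lerBrDr [x * a]mulrC.
  rewrite !lebesgue_measure_itv/= !lte_fin ltr_pM2r ?invr_gt0// ltrD2r.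
  case: ifPn => _; last by rewrite mule0.
  by rewrite -!EFinD -EFinM gtr0_norm//; congr EFin; field.
have {}an : a < 0 by rewrite lt_neqAle a0.
have -> : phi @^-1` `]p, q] = `[(q - b) / a, (p - b) / a[%classic.
  apply/seteqP; split=> x /=; rewrite !in_itv/= /phi;
    by rewrite ltr_ndivlMr// ler_ndivrMr// ltrBlDr lerBrDr [x * a]mulrC andbC.
rewrite !lebesgue_measure_itv/= !lte_fin ltr_nM2r ?invr_lt0// ltrD2r.
case: ifPn => _; last by rewrite mule0.
by rewrite -!EFinD -EFinM ltr0_norm//; congr EFin; field.
Qed.

Lemma ge0_integral_affine (a b : R) (D : set T) (f : T -> \bar R) : a != 0 ->
  measurable D -> measurable_fun D f -> (forall x, D x -> 0 <= f x)%E ->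
  (\int[mu]_(x in D) f x =
   \int[mu]_(x in (fun x : R => a * x + b)%R @^-1` D) (`|a|%:E * f (a * x + b)%R))%E.
Proof.
move=> a0 mD mf f0; pose phi : T -> T := fun x : R => a * x + b.
have mphi : measurable_fun setT phi.
  by apply: measurable_funD => //; exact: measurable_funM.
have mphiD : measurable (phi @^-1` D).
  by rewrite -[_ @^-1` _]setTI; exact: mphi.
rewrite (eq_measure_integral (mscale (NngNum (normr_ge0 a))
  (measure_function_pushforward__canonical__measure_function_Measure mu mphi))); last first.
  by move=> A mA _; exact: lebesgue_measure_affine.
rewrite ge0_integral_mscale// ge0_integral_pushforward//; last first.
  by move=> x /set_mem; exact: f0.
rewrite [RHS]ge0_integralZl//.
- apply: (@measurable_comp _ _ _ _ _ _ D) => //.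
    by move=> _ [x Dx <-].
  exact: measurable_funS mphi.
- by move=> x Dx; exact: f0.
Qed.

Definition plane_affine (a1 b1 a2 b2 : R) (p : R * R) : R * R :=
  (a1 * p.1 + b1, a2 * p.2 + b2).

Lemma measurable_plane_affine a1 b1 a2 b2 :
  measurable_fun setT (plane_affine a1 b1 a2 b2 : T * T -> T * T).
Proof.
apply/measurable_fun_pairP; split.
  by apply: measurable_funD => //; exact: measurable_funM.
by apply: measurable_funD => //; exact: measurable_funM.
Qed.

Lemma area_affine a1 b1 a2 b2 (A : set (T * T)) : a1 != 0 -> a2 != 0 ->
  measurable A ->
  area A = (`|a1 * a2|%:E * area (plane_affine a1 b1 a2 b2 @^-1` A))%E.
Proof.
move=> a10 a20 mA; have mphi := measurable_plane_affine a1 b1 a2 b2.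
pose nu := mscale (NngNum (normr_ge0 (a1 * a2)))
  (measure_function_pushforward__canonical__measure_function_Measure area mphi).
rewrite -[RHS]/(nu A); apply: product_measure_unique => // {mA}A B mA mB.
rewrite /nu /mscale/= /pushforward.
rewrite [X in (_ * X)%E = _](_ : _ = area
  (((fun x : R => a1 * x + b1) @^-1` A) `*` ((fun x : R => a2 * x + b2) @^-1` B)))//.

have maff (a b : R) (C : set T) : measurable C ->
    measurable ((fun x : R => a * x + b) @^-1` C : set T).
  move=> mC; rewrite -[_ @^-1` _]setTI.
  have : measurable_fun setT ((fun x : R => a * x + b) : T -> T).
    by apply: measurable_funD => //; exact: measurable_funM.
  by apply.
rewrite product_measure1E//=; [|exact: maff|exact: maff].
rewrite (lebesgue_measure_affine b1 a10 mA) (lebesgue_measure_affine b2 a20 mB).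
by rewrite normrM EFinM muleACA.
Qed.

Lemma ge0_area_integral_affine a1 b1 a2 b2 (D D' : set (T * T))
    (f : T * T -> \bar R) : a1 != 0 -> a2 != 0 ->
  plane_affine a1 b1 a2 b2 @^-1` D = D' ->
  measurable D -> measurable_fun D f -> (forall x, D x -> 0 <= f x)%E ->
  (\int[area]_(p in D) f p =
   \int[area]_(p in D')
     (`|a1 * a2|%:E * f (plane_affine a1 b1 a2 b2 p)))%E.
Proof.
move=> a10 a20 <- mD mf f0; have mphi := measurable_plane_affine a1 b1 a2 b2.
have mphiD : measurable (plane_affine a1 b1 a2 b2 @^-1` D : set (T * T)).
  by rewrite -[_ @^-1` _]setTI; exact: mphi.
rewrite (eq_measure_integral (mscale (NngNum (normr_ge0 (a1 * a2)))
  (measure_function_pushforward__canonical__measure_function_Measure area mphi))); last first.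
  by move=> A mA _; exact: area_affine.
rewrite ge0_integral_mscale// ge0_integral_pushforward//; last first.
  by move=> x /set_mem; exact: f0.
rewrite [RHS]ge0_integralZl//.
- apply: (@measurable_comp _ _ _ _ _ _ D) => //.
    by move=> _ [x Dx <-].
  exact: measurable_funS mphi.
- by move=> x Dx; exact: f0.
Qed.

(** No integrability is assumed: positive and negative parts are transported separately. *)
Lemma area_integral_affine a1 b1 a2 b2 (D D' : set (T * T))
    (f : T * T -> \bar R) : a1 != 0 -> a2 != 0 ->
  plane_affine a1 b1 a2 b2 @^-1` D = D' ->
  measurable D -> measurable_fun D f ->
  (\int[area]_(p in D) f p =
   \int[area]_(p in D')
     (`|a1 * a2|%:E * f (plane_affine a1 b1 a2 b2 p)))%E.
Proof.
move=> a10 a20 E mD mf; rewrite integralE [RHS]integralE.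
rewrite (ge0_area_integral_affine a10 a20 E mD (measurable_funepos mf))//.
rewrite (ge0_area_integral_affine a10 a20 E mD (measurable_funeneg mf))//.
congr (_ - _)%E; apply: eq_integral => p _.
  by rewrite (ge0_funeposM _ (normr_ge0 _)) !funeposE.
by rewrite (ge0_funenegM _ (normr_ge0 _)) !funenegE.
Qed.

End PlaneMeasure.

(** * Goursat's lemma for differential forms on rectangles *)

Section SegmentIntegral.
Variable R : realType.
Local Notation mu := (@lebesgue_measure R).
Implicit Types (f : R -> R) (a b : R).

(** Continuity is two-sided even at the endpoints, so it restricts to subsegments at once; the
    functions integrated below are continuous in a neighbourhood of the segment. *)
Definition continuous_on_seg f a b :=
  forall x, a <= x <= b -> {for x, continuous f}.

Lemma seg_integrable f a b : continuous_on_seg f a b ->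
  mu.-integrable `[a, b] (EFin \o f).
Proof.
move=> cf; apply: continuous_compact_integrable; first exact: segment_compact.
by apply: continuous_in_subspaceT => x /[!inE]/=; rewrite in_itv/=; exact: cf.
Qed.

Lemma continuous_on_segS f a b a' b' : a <= a' -> b' <= b ->
  continuous_on_seg f a b -> continuous_on_seg f a' b'.
Proof.
by move=> aa bb cf x /andP[ax xb]; apply: cf; rewrite (le_trans aa) ?(le_trans xb).
Qed.

Lemma seg_split f a m b : a <= m -> m <= b -> continuous_on_seg f a b ->
  \int[mu]_(x in `[a, b]) f x =
  \int[mu]_(x in `[a, m]) f x + \int[mu]_(x in `[m, b]) f x.
Proof.
move=> am mb cf; have fab := seg_integrable cf.
have := Rintegral_itvB fab; move=> /(_ m); rewrite !bnd_simp => /(_ am mb) E.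
rewrite -[X in _ + X]Rintegral_itv_obnd_cbnd.
  by rewrite -E; ring.
by apply: integrableS fab => //; apply: subset_itvr; rewrite bnd_simp.
Qed.

Lemma seg_cst (k a b : R) : a <= b -> \int[mu]_(x in `[a, b]) k = k * (b - a).
Proof.
rewrite Rintegral_cst//=. rewrite lebesgue_measure_itv/= lte_fin le_eqVlt.
by move=> /predU1P[->|->//=]; rewrite ltxx subrr.
Qed.

Lemma continuous_on_seg_cst (k a b : R) : continuous_on_seg (fun=> k) a b.
Proof. by move=> z _; exact: cvg_cst. Qed.

Lemma seg_bound f (a b M : R) : a <= b -> continuous_on_seg f a b ->
  (forall x, a <= x <= b -> `|f x| <= M) ->
  `|\int[mu]_(x in `[a, b]) f x| <= M * (b - a).
Proof.
move=> ab cf fM; have fab := seg_integrable cf.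
apply: le_trans (le_normr_Rintegral _ fab) _ => //.
rewrite -(seg_cst M ab); apply: le_Rintegral => //.
- exact: integrable_norm.
- exact/seg_integrable/continuous_on_seg_cst.
Qed.

End SegmentIntegral.

Section Goursat.
Variable R : realType.
Local Notation mu := (@lebesgue_measure R).

Lemma nested_segments (a b : nat -> R) :
  (forall n, a n <= a n.+1) -> (forall n, b n.+1 <= b n) ->
  (forall n, a n <= b n) -> exists x, forall n, a n <= x <= b n.
Proof.
move=> ha hb ab.
have ua : nondecreasing_seq a by apply/nondecreasing_seqP.
have ub : nonincreasing_seq b by apply/nonincreasing_seqP.
have abnm n m : a n <= b m.
  have [nm|/ltnW mn] := leqP n m.
    by rewrite (le_trans (ua _ _ nm)).
  by rewrite (le_trans (ab n))// ub.
have A0 : has_sup (range a).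
  by split; [exists (a 0%N), 0%N|exists (b 0%N) => _ [n _ <-]].
exists (sup (range a)) => n; apply/andP; split.
  by apply: sup_upper_bound => //; exists n.
by apply: ge_sup; [exists (a 0%N), 0%N|move=> _ [m _ <-]].
Qed.

(** Quartering argument: if [Q] fails on a rectangle it fails on one of its quarters, and the nested
    bad rectangles shrink to a point at which the local hypothesis is contradicted. *)
Lemma bisection (Q : R -> R -> R -> R -> Prop) (a0 b0 c0 d0 : R) :
  a0 <= b0 -> c0 <= d0 ->
  (forall a b c d, a0 <= a -> a <= b -> b <= b0 ->
     c0 <= c -> c <= d -> d <= d0 ->
     let m := (a + b) / 2 in let n := (c + d) / 2 in
     Q a m c n -> Q m b c n -> Q a m n d -> Q m b n d -> Q a b c d) ->
  (forall x y, a0 <= x <= b0 -> c0 <= y <= d0 ->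
     exists2 r : R, 0 < r & forall a b c d, a0 <= a -> a <= x -> x <= b ->
       b <= b0 -> c0 <= c -> c <= y -> y <= d -> d <= d0 ->
       b - a < r -> d - c < r -> Q a b c d) ->
  Q a0 b0 c0 d0.
Proof.
move=> ab0 cd0 Qsplit Qloc; apply: contrapT => NQ.
pose T := ((R * R) * (R * R))%type.
pose ok (t : T) := [/\ a0 <= t.1.1, t.1.1 <= t.1.2, t.1.2 <= b0 &
  [/\ c0 <= t.2.1, t.2.1 <= t.2.2, t.2.2 <= d0 &
    ~ Q t.1.1 t.1.2 t.2.1 t.2.2]].
pose sub (t s : T) := [/\ t.1.1 <= s.1.1, s.1.2 <= t.1.2, t.2.1 <= s.2.1 &
  [/\ s.2.2 <= t.2.2, s.1.2 - s.1.1 = (t.1.2 - t.1.1) / 2 &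
      s.2.2 - s.2.1 = (t.2.2 - t.2.1) / 2]].
have step (t : T) : exists s, ok t -> ok s /\ sub t s.
  have [okt|] := pselect (ok t); last by exists t.
  case: t okt => [[a b] [c d]] [/= aa ab bb [cc cd dd NQt]].
  pose m := (a + b) / 2; pose n := (c + d) / 2.
  have am : a <= m by rewrite /m; lra.
  have mb : m <= b by rewrite /m; lra.
  have cn : c <= n by rewrite /n; lra.
  have nd : n <= d by rewrite /n; lra.
  (* If no quarter were bad, [Q] would hold on all four, hence on the parent. *)
  apply: contrapT => /forallNP H; apply: NQt.
  have sol a' b' c' d' : a <= a' -> a' <= b' -> b' <= b -> c <= c' -> c' <= d' ->
      d' <= d -> b' - a' = (b - a) / 2 -> d' - c' = (d - c) / 2 -> Q a' b' c' d'.
    move=> h1 h2 h3 h4 h5 h6 h7 h8; apply: contrapT => NQ'.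
    apply: (H ((a', b'), (c', d'))) => _; split; split=> //=.
    - exact: le_trans h1.
    - exact: le_trans bb.
    - split=> //; first exact: le_trans h4.
      exact: le_trans dd.
  by apply: Qsplit => //; apply: sol; rewrite ?lexx// /m /n; lra.
pose nxt t := projT1 (cid (step t)).
pose s n := iter n nxt ((a0, b0), (c0, d0)).
have oks n : ok (s n).
  elim: n => [|n IH]; first by split=> //; split.
  by have [] := projT2 (cid (step (s n))) IH.
have subs n : sub (s n) (s n.+1).
  by have [] := projT2 (cid (step (s n))) (oks n).
have [x hx] : exists x, forall n, (s n).1.1 <= x <= (s n).1.2.
  by apply: nested_segments => n; [have [] := subs n|have [] := subs n|
    have [] := oks n].
have [y hy] : exists y, forall n, (s n).2.1 <= y <= (s n).2.2.
  apply: nested_segments => n; [by have [] := subs n| |].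
  - by have [_ _ _ []] := subs n.
  - by have [_ _ _ []] := oks n.
have w1 n : (s n).1.2 - (s n).1.1 = (b0 - a0) / 2 ^+ n.
  elim: n => [|n IH]; first by rewrite expr0 divr1.
  have [_ _ _ [_ -> _]] := subs n.
  by rewrite IH exprS invfM; ring.
have w2 n : (s n).2.2 - (s n).2.1 = (d0 - c0) / 2 ^+ n.
  elim: n => [|n IH]; first by rewrite expr0 divr1.
  have [_ _ _ [_ _ ->]] := subs n.
  by rewrite IH exprS invfM; ring.
have [r r0 Qr] := Qloc x y (hx 0%N) (hy 0%N).
have [n nr] : exists n, (b0 - a0 + (d0 - c0)) / r < 2 ^+ n.
  exists (Num.bound ((b0 - a0 + (d0 - c0)) / r)).
  rewrite (lt_trans (archi_boundP _))//.
    by rewrite divr_ge0// ?(ltW r0)//; lra.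
  by rewrite -natrX ltr_nat ltn_expl.
have {}nr : (b0 - a0 + (d0 - c0)) / 2 ^+ n < r.
  by rewrite ltr_pdivrMr ?exprn_gt0// mulrC -ltr_pdivrMr.
have [h1 h2 h3 [h4 h5 h6 NQn]] := oks n; apply: NQn.
have /andP[? ?] := hx n; have /andP[? ?] := hy n.
have p2 : 0 <= (2 ^+ n : R)^-1 by rewrite invr_ge0 exprn_ge0.
apply: Qr => //.
- rewrite w1 (le_lt_trans _ nr)// ler_wpM2r//; lra.
- rewrite w2 (le_lt_trans _ nr)// ler_wpM2r//; lra.
Qed.

(** Total differentiability with partial derivatives [p] and [q], measured in the l^1 norm. Sharing
    a number between the y-slope of P and the x-slope of Q says pointwise that P dx + Q dy is
    closed, without continuity of the partial derivatives. *)
Definition diff2 (F : R -> R -> R) (x y p q : R) := forall e : R, 0 < e ->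
  exists2 r : R, 0 < r & forall u v, `|u - x| < r -> `|v - y| < r ->
    `|F u v - F x y - p * (u - x) - q * (v - y)| <= e * (`|u - x| + `|v - y|).

Lemma diff2_continuous F x y p q : diff2 F x y p q ->
  {for x, continuous (F ^~ y)} /\ {for y, continuous (F x)}.
Proof.
move=> dF; have [r r0 Fr] := dF 1 ltr01.
(* With error constant 1, this number is a local Lipschitz constant at the point. *)
have C : 0 < 1 + `|p| + `|q| by rewrite ltr_pwDl// addr_ge0.
split; apply/cvgrPdist_lt => e e0; apply/nbhs_ballP.
  exists (Num.min r (e / (1 + `|p| + `|q|))) => /=.
    by rewrite lt_min r0 divr_gt0.
  move=> u; rewrite /ball/= lt_min => /andP[]; rewrite distrC => ur ue.
  have := Fr u y ur; rewrite subrr normr0 => /(_ r0).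
  rewrite mulr0 subr0 addr0 mul1r => h.
  rewrite distrC (_ : _ - _ = (F u y - F x y - p * (u - x)) + p * (u - x)); last by ring.
  rewrite (le_lt_trans (ler_normD _ _))// normrM.
  have : (1 + `|p| + `|q|) * `|u - x| < e by rewrite mulrC -ltr_pdivlMr.
  have : 0 <= `|q| * `|u - x| by rewrite mulr_ge0.
  nra.
exists (Num.min r (e / (1 + `|p| + `|q|))) => /=.
  by rewrite lt_min r0 divr_gt0.
move=> u; rewrite /ball/= lt_min => /andP[]; rewrite distrC => ur ue.
have := Fr x u; rewrite subrr normr0 => /(_ r0 ur).
rewrite mulr0 subr0 add0r mul1r => h.
rewrite distrC (_ : _ - _ = (F x u - F x y - q * (u - y)) + q * (u - y)); last by ring.
rewrite (le_lt_trans (ler_normD _ _))// normrM.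
have : (1 + `|p| + `|q|) * `|u - y| < e by rewrite mulrC -ltr_pdivlMr.
have : 0 <= `|p| * `|u - y| by rewrite mulr_ge0.
nra.
Qed.

(* By bisection: on a small rectangle around a point the circulation is
   [o(diameter ^ 2)], the first-order terms cancelling as [dP/dy = dQ/dx]. *)
Lemma goursat (P Q : R -> R -> R) (a0 b0 c0 d0 : R) :
  a0 <= b0 -> c0 <= d0 ->
  (forall x y, a0 <= x <= b0 -> c0 <= y <= d0 ->
    exists p m q, diff2 P x y p m /\ diff2 Q x y m q) ->
  \int[mu]_(x in `[a0, b0]) P x c0 - \int[mu]_(x in `[a0, b0]) P x d0 +
  (\int[mu]_(y in `[c0, d0]) Q b0 y - \int[mu]_(y in `[c0, d0]) Q a0 y) = 0.
Proof.
move=> ab0 cd0 dPQ.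
pose circ a b c d :=
  \int[mu]_(x in `[a, b]) P x c - \int[mu]_(x in `[a, b]) P x d +
  (\int[mu]_(y in `[c, d]) Q b y - \int[mu]_(y in `[c, d]) Q a y).
have cP y : c0 <= y <= d0 -> continuous_on_seg (P ^~ y) a0 b0.
  move=> yy x xx; have [p [m [q [h _]]]] := dPQ _ _ xx yy.
  by have [] := diff2_continuous h.
have cQ x : a0 <= x <= b0 -> continuous_on_seg (Q x) c0 d0.
  move=> xx y yy; have [p [m [q [_ h]]]] := dPQ _ _ xx yy.
  by have [] := diff2_continuous h.
(* The squared half-perimeter is additive under quartering, as 4 (s/2)^2 = s^2, so the same [e]
   passes from the quarters to the whole. *)
have key e : 0 < e ->
    `|circ a0 b0 c0 d0| <= e * ((b0 - a0) + (d0 - c0)) ^+ 2.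
  move=> e0; apply: (bisection (Q := fun a b c d =>
    `|circ a b c d| <= e * ((b - a) + (d - c)) ^+ 2)) => //.
    move=> a b c d aa ab bb cc cd dd m n h1 h2 h3 h4.
    have am : a <= m by rewrite /m; lra.
    have mb : m <= b by rewrite /m; lra.
    have cn : c <= n by rewrite /n; lra.
    have nd : n <= d by rewrite /n; lra.
    have sP y : c <= y <= d -> \int[mu]_(x in `[a, b]) P x y =
      \int[mu]_(x in `[a, m]) P x y + \int[mu]_(x in `[m, b]) P x y.
      move=> /andP[cy yd]; apply: seg_split => //.
      apply: continuous_on_segS (cP _ _) => //.
      by rewrite (le_trans cc)// (le_trans yd).
    have sQ x : a <= x <= b -> \int[mu]_(y in `[c, d]) Q x y =
      \int[mu]_(y in `[c, n]) Q x y + \int[mu]_(y in `[n, d]) Q x y.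
      move=> /andP[ax xb]; apply: seg_split => //.
      apply: continuous_on_segS (cQ _ _) => //.
      by rewrite (le_trans aa)// (le_trans xb).
    have -> : circ a b c d =
        circ a m c n + circ m b c n + circ a m n d + circ m b n d.
      rewrite /circ !sP ?lexx ?cd// !sQ ?lexx ?ab//.
      by ring.
    have E1 : (m - a + (n - c)) = (b - a + (d - c)) / 2 by rewrite /m /n; field.
    have E2 : (b - m + (n - c)) = (b - a + (d - c)) / 2 by rewrite /m /n; field.
    have E3 : (m - a + (d - n)) = (b - a + (d - c)) / 2 by rewrite /m /n; field.
    have E4 : (b - m + (d - n)) = (b - a + (d - c)) / 2 by rewrite /m /n; field.
    move: h1 h2 h3 h4; rewrite E1 E2 E3 E4 => h1 h2 h3 h4.
    rewrite (_ : e * _ = e * ((b - a + (d - c)) / 2) ^+ 2 +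
      e * ((b - a + (d - c)) / 2) ^+ 2 + e * ((b - a + (d - c)) / 2) ^+ 2 +
      e * ((b - a + (d - c)) / 2) ^+ 2); last by field.
    do 3 (apply: le_trans (ler_normD _ _) _; apply: lerD => //).
  move=> x y xx yy; have [p [m [q [dP dQ]]]] := dPQ _ _ xx yy.
  (* Each pair of opposite sides contributes two error terms, hence the half. *)
  have e2 : 0 < e / 2 by rewrite divr_gt0.
  have [r1 r10 Pr] := dP _ e2; have [r2 r20 Qr] := dQ _ e2.
  exists (Num.min r1 r2); first by rewrite lt_min r10.
  move=> a b c d aa ax xb bb cc cy yd dd.
  rewrite !lt_min => /andP[ba1 ba2] /andP[dc1 dc2].
  have ab : a <= b by lra.
  have cd : c <= d by lra.
  have cP' v : c <= v <= d -> continuous_on_seg (P ^~ v) a b.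
    move=> vv; apply: continuous_on_segS (cP _ _) => //; lra.
  have cQ' v : a <= v <= b -> continuous_on_seg (Q v) c d.
    move=> vv; apply: continuous_on_segS (cQ _ _) => //; lra.
  pose s := b - a + (d - c).
  have hP u v : a <= u <= b -> c <= v <= d ->
      `|P u v - P x y - p * (u - x) - m * (v - y)| <= e / 2 * s.
    move=> uu vv; have ux : `|u - x| <= b - a by rewrite ler_norml; lra.
    have vy : `|v - y| <= d - c by rewrite ler_norml; lra.
    apply: le_trans (Pr _ _ _ _) _; [lra|lra|].
    by rewrite ler_pM2l// /s lerD.
  have hQ u v : a <= u <= b -> c <= v <= d ->
      `|Q u v - Q x y - m * (u - x) - q * (v - y)| <= e / 2 * s.
    move=> uu vv; have ux : `|u - x| <= b - a by rewrite ler_norml; lra.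
    have vy : `|v - y| <= d - c by rewrite ler_norml; lra.
    apply: le_trans (Qr _ _ _ _) _; [lra|lra|].
    by rewrite ler_pM2l// /s lerD.
  (* The correction [m * (d - c)] here and [- m * (b - a)] in [B2] have opposite integrals, so they
     cancel in the circulation. This is where the equality of the mixed slopes enters. *)
  have B1 : `|\int[mu]_(x in `[a, b]) (P x c - P x d + m * (d - c))|
      <= (e * s) * (b - a).
    apply: seg_bound => //.
      move=> z zz; apply: cvgD; last exact: cvg_cst.
      by apply: cvgB; apply: cP'; rewrite ?lexx ?cd.
    move=> z zz.
    rewrite (_ : _ + _ = (P z c - P x y - p * (z - x) - m * (c - y)) -
      (P z d - P x y - p * (z - x) - m * (d - y))); last by ring.
    rewrite (le_trans (ler_normB _ _))//.
    have := hP z c zz; rewrite lexx cd => /(_ isT).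
    have := hP z d zz; rewrite lexx cd => /(_ isT).
    lra.
  have B2 : `|\int[mu]_(y in `[c, d]) (Q b y - Q a y - m * (b - a))|
      <= (e * s) * (d - c).
    apply: seg_bound => //.
      move=> z zz; apply: cvgB; last exact: cvg_cst.
      by apply: cvgB; apply: cQ'; rewrite ?lexx ?ab.
    move=> z zz.
    rewrite (_ : _ - _ = (Q b z - Q x y - m * (b - x) - q * (z - y)) -
      (Q a z - Q x y - m * (a - x) - q * (z - y))); last by ring.
    rewrite (le_trans (ler_normB _ _))//.
    have := hQ a z; rewrite lexx ab => /(_ isT zz).
    have := hQ b z; rewrite lexx ab => /(_ isT zz).
    lra.
  have iP v : c <= v <= d -> mu.-integrable `[a, b] (EFin \o (P ^~ v)).
    by move=> vv; apply: seg_integrable; exact: cP'.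
  have iQ u : a <= u <= b -> mu.-integrable `[c, d] (EFin \o (Q u)).
    by move=> vv; apply: seg_integrable; exact: cQ'.
  have -> : circ a b c d =
     \int[mu]_(x in `[a, b]) (P x c - P x d + m * (d - c)) +
     \int[mu]_(y in `[c, d]) (Q b y - Q a y - m * (b - a)).
    rewrite RintegralD//; last 2 first.
    - apply: seg_integrable => z zz.
      by apply: cvgB; apply: cP'; rewrite ?lexx ?cd.
    - exact/seg_integrable/continuous_on_seg_cst.
    rewrite RintegralB//; last 2 first.
    - by apply: iP; rewrite ?lexx ?cd.
    - by apply: iP; rewrite ?lexx ?cd.
    rewrite RintegralB//; last 2 first.
    - apply: seg_integrable => z zz.
      by apply: cvgB; apply: cQ'; rewrite ?lexx ?ab.
    - exact/seg_integrable/continuous_on_seg_cst.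
    rewrite RintegralB//; last 2 first.
    - by apply: iQ; rewrite ?lexx ?ab.
    - by apply: iQ; rewrite ?lexx ?ab.
    by rewrite !seg_cst// /circ; ring.
  rewrite (le_trans (ler_normD _ _))// (le_trans (lerD B1 B2))//.
  by rewrite -/s -mulrDr expr2 mulrA.
apply/eqP; rewrite -normr_eq0 -/(circ a0 b0 c0 d0) eq_le normr_ge0 andbT.
set K := (b0 - a0 + (d0 - c0)) ^+ 2 in key.
have K0 : 0 <= K by rewrite sqr_ge0.
apply/ler_addgt0Pr => e e0; rewrite add0r.
have K1 : 0 < 1 + K by rewrite ltr_pwDl.
apply: le_trans (key (e / (1 + K)) _) _; first by rewrite divr_gt0.
rewrite mulrAC ler_pdivrMr// ler_pM2l//; lra.
Qed.

End Goursat.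

(** * Transport of integrals across a strip *)

Section Strip.
Variable R : realType.
Local Notation mu := (@lebesgue_measure R).
Variables (P Q : R -> R -> R) (a b : R).
Hypothesis ab : a <= b.
Hypothesis dPQ : forall x y, a <= x <= b ->
  exists p m q, diff2 P x y p m /\ diff2 Q x y m q.

(** Bounds the contribution of the horizontal side at height [y]. *)
Let K (y : R) := (\int[mu]_(x in `[a, b]) (`|P x y|)%:E)%E.

Let K_ge0 y : (0 <= K y)%E.
Proof. by apply: integral_ge0 => x _; rewrite lee_fin. Qed.

Let cP y : continuous_on_seg (P ^~ y) a b.
Proof.
move=> x xx; have [p [m [q [h _]]]] := dPQ y xx.
by have [] := diff2_continuous h.
Qed.

Let cQ x c d : a <= x <= b -> continuous_on_seg (Q x) c d.
Proof.
move=> xx y _; have [p [m [q [_ h]]]] := dPQ y xx.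
by have [] := diff2_continuous h.
Qed.

(** Goursat on [[a, b]] times [[- N, N]]: the vertical sides differ by exactly what the horizontal
    sides contribute. *)
Let horizontal_bound N : 0 <= N ->
  (`|\int[mu]_(y in `[- N, N]) (Q b y - Q a y)|%:E <= K N + K (- N)%R)%E.
Proof.
move=> N0; have NN : - N <= N by lra.
have IK y : (`|\int[mu]_(x in `[a, b]) P x y|%:E <= K y)%E.
  have iP : mu.-integrable `[a, b] (EFin \o (P ^~ y)) by apply: seg_integrable; exact: cP.
  rewrite EFin_normr_Rintegral// /K.
  by have /integrableP[mP _] := iP; exact: le_abse_integral.
rewrite RintegralB//; [|apply: seg_integrable; apply: cQ|apply: seg_integrable; apply: cQ];
  rewrite ?lexx ?ab//.
have := goursat ab NN (fun x y xx _ => dPQ y xx) => G.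
rewrite (_ : _ - _ = \int[mu]_(x in `[a, b]) P x N - \int[mu]_(x in `[a, b]) P x (- N));
  last by lra.
rewrite (@le_trans _ _ (`|\int[mu]_(x in `[a, b]) P x N|%:E +
  `|\int[mu]_(x in `[a, b]) P x (- N)%R|%:E)%E)//; last by rewrite leeD.
by rewrite -EFinD lee_fin ler_normB.
Qed.

(** An integrable [K] must be small at suitable pairs of heights N and -N; along these the vertical
    integrals become equal in the limit. *)
Lemma strip_transport :
  measurable_fun setT (fun y : R => \int[mu]_(x in `[a, b]) (`|P x y|)%:E)%E ->
  (\int[mu]_y (\int[mu]_(x in `[a, b]) (`|P x y|)%:E) < +oo)%E ->
  mu.-integrable setT (EFin \o Q a) -> mu.-integrable setT (EFin \o Q b) ->
  \int[mu]_y Q b y = \int[mu]_y Q a y.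
Proof.
move=> mK finK iQa iQb.
have mKN : measurable_fun setT (fun y : R => K (- y)).
  by apply: (measurableT_comp (f := K)) => //; exact: oppr_measurable.
have KN : (\int[mu]_y K (- y) = \int[mu]_y K y)%E.
  rewrite [RHS](ge0_integral_affine (a := -1) 0) ?oppr_eq0 ?oner_eq0//.
  rewrite preimage_setT; apply: eq_integral => y _.
  by rewrite normrN1 mul1e mulN1r addr0.
(* Otherwise [K N + K (- N)] would stay above a positive constant on the half-line from [n] on, and
   its integral, twice that of [K], would be infinite. *)
have sel n : exists2 N : R, n%:R <= N & (K N + K (- N)%R < (n.+1%:R^-1)%:E)%E.
  apply: contrapT => /forall2NP H.
  have : (\int[mu]_(y in `[n%:R : R, +oo[) ((n.+1%:R : R)^-1)%:E <=
      \int[mu]_y (K y + K (- y)%R))%E.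
    apply: (@le_trans _ _ (\int[mu]_(y in `[n%:R : R, +oo[) (K y + K (- y)%R))%E).
      apply: ge0_le_integral => //.
      - by apply: measurable_funTS; exact: emeasurable_funD.
      - move=> y /=; rewrite in_itv/= andbT => ny.
        by have [//|/negP] := H y; rewrite -leNgt.
    apply: ge0_subset_integral => //.
      exact: emeasurable_funD.
    by move=> y _; exact: adde_ge0.
  rewrite ge0_integralD// integral_cst//= lebesgue_measure_itv/= ltry addye//.
  rewrite gt0_muley ?lte_fin// leye_eq => /eqP E.
  move: E; rewrite KN; move: finK; rewrite -[X in (X < _)%E]/(\int[mu]_y K y)%E.
  by case: (\int[mu]_y K y)%E.
pose N n := sval (cid2 (sel n)).
have Nn n : n%:R <= N n by rewrite /N; case: cid2.
have KNn n : (K (N n) + K (- N n)%R < (n.+1%:R^-1)%:E)%E by rewrite /N; case: cid2.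
pose g y := Q b y - Q a y.
have ig : mu.-integrable setT (EFin \o g).
  by have := integrableB (measurableT) iQb iQa.
pose f_ n (y : R) := ((g \_ `[- N n, N n]) y)%:E.
have mg : measurable_fun setT g by have /integrableP[/measurable_EFinP] := ig.
(* Since [N n] is at least [n], the truncations of [g] are eventually equal to it at each point; [g]
   itself gives the majorant. *)
have [] := @dominated_convergence _ _ _ mu setT measurableT f_ (EFin \o g)
  (fun y => `|(g y)%:E|%E).
- move=> n; apply/measurable_EFinP.
  by apply/(measurable_restrictT _ _).1 => //; exact: measurable_funTS.
- exact/measurable_EFinP.
- apply: aeW => y _; apply: cvg_near_cst.
  near=> n; rewrite /f_/= patchE mem_set//= in_itv/= -ler_norml.
  apply: le_trans (Nn n); near: n.
  exact: nbhs_infty_ger.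
- exact: integrable_abse.
- apply: aeW => y n _; rewrite /f_ patchE; case: ifPn => // _.
  by rewrite /= normr0 lee_fin.
move=> _ _ cv.
have {}cv : \int[mu]_(y in `[- N n, N n]) g y @[n --> \oo] --> \int[mu]_y g y.
  have fi : (\int[mu]_y (g y)%:E)%E \is a fin_num by exact: integrable_fin_num.
  rewrite /Rintegral; apply: fine_cvg; rewrite fineK//.
  apply: cvg_trans cv; apply: near_eq_cvg; near=> n.
  by rewrite integral_mkcond; apply: eq_integral => y _; rewrite /f_ restrict_EFin.
have : \int[mu]_y g y = 0.
  apply: (cvg_unique _ cv) => //.
  apply/norm_cvg0P; apply: (@squeeze_cvgr _ _ _ _ (fun=> 0) (fun n => n.+1%:R^-1)).
  - near=> n; rewrite normr_ge0/= -lee_fin.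
    rewrite (le_trans _ (ltW (KNn n)))// horizontal_bound//.
    exact: le_trans (Nn n).
  - exact: cvg_cst.
  - exact: cvg_harmonic.
by rewrite RintegralB// => /eqP; rewrite subr_eq0 => /eqP.
Unshelve. all: by end_near. Qed.

End Strip.

(** * Integrals over the right half-plane and inversion *)

Section RightHalf.
Variable R : realType.
Local Notation T := (measurableTypeR R).
Local Notation mu := (@lebesgue_measure R).
Local Notation area := (@lebesgue_measure R \x @lebesgue_measure R)%E.
Local Notation rhalf := (@right_half R).
Implicit Types F : R * R -> R.

(** Required only on the open half-plane, where [hext] is continuous; measurability of all
    integrands below is derived from it. *)
Definition cont_rh F := forall p : R * R, 0 < p.1 -> {for p, continuous F}.

Lemma right_halfE : rhalf = (`]0, +oo[ `*` setT).
Proof.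
by apply/seteqP; split=> [[x y]|[x y] []] /=; rewrite /right_half/= in_itv/= andbT.
Qed.

Lemma open_right_half : open rhalf.
Proof.
rewrite right_halfE openE => -[x y] /= [x0 _].
exists (`]0, +oo[%classic, setT) => /=; last by move=> [].
split; last exact: filterT.
by apply: open_nbhs_nbhs; split.
Qed.

Lemma measurable_right_half : measurable (rhalf : set (T * T)).
Proof. by apply: open_measurable2; exact: open_right_half. Qed.

Lemma cont_rh_measurable F : cont_rh F ->
  measurable_fun (rhalf : set (T * T)) (F : T * T -> R).
Proof. by move=> cF; apply: continuous_measurable2; first exact: open_right_half. Qed.

Lemma continuous_pair (U V W : topologicalType) (f : U -> V) (g : U -> W) x :
  {for x, continuous f} -> {for x, continuous g} ->
  {for x, continuous (fun y => (f y, g y))}.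
Proof. by move=> cf cg; exact: (cvg_pair cf cg). Qed.

Lemma cont_rh_comp F (phi : R * R -> R * R) :
  (forall p, 0 < p.1 -> 0 < (phi p).1) ->
  cont_rh (fst \o phi) -> cont_rh (snd \o phi) -> cont_rh F ->
  cont_rh (F \o phi).
Proof.
move=> phi0 c1 c2 cF p p0; apply: continuous_comp; last exact/cF/phi0.
rewrite (_ : phi = fun q => ((fst \o phi) q, (snd \o phi) q)); last first.
  by apply/funext => q /=; case: (phi q).
by apply: continuous_pair; [exact: c1|exact: c2].
Qed.

Lemma cont_rh_fst : cont_rh fst. Proof. by move=> p _; exact: cvg_fst. Qed.

Lemma cont_rh_snd : cont_rh snd. Proof. by move=> p _; exact: cvg_snd. Qed.

Lemma cont_rh_cst (c : R) : cont_rh (fun=> c).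
Proof. by move=> p _; exact: cvg_cst. Qed.

Lemma cont_rhM F G : cont_rh F -> cont_rh G -> cont_rh (fun p => F p * G p).
Proof. by move=> cF cG p p0; apply: continuousM; [exact: cF|exact: cG]. Qed.

Lemma cont_rhD F G : cont_rh F -> cont_rh G -> cont_rh (fun p => F p + G p).
Proof. by move=> cF cG p p0; apply: continuousD; [exact: cF|exact: cG]. Qed.

Lemma cont_rhX F n : cont_rh F -> cont_rh (fun p => F p ^+ n).
Proof.
move=> cF; elim: n => [|n IH]; first exact: cont_rh_cst.
rewrite (_ : (fun _ => _) = fun p => F p * F p ^+ n); first exact: cont_rhM.
by apply/funext => p; rewrite exprS.
Qed.

Lemma cont_rh_section2 F (x : R) : cont_rh F -> 0 < x ->
  forall y : R, {for y, continuous (fun y => F (x, y))}.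
Proof.
move=> cF x0 y; apply: (@continuous_comp _ _ _ (fun y : R => (x, y))); last exact: cF.
by apply: continuous_pair; [exact: cvg_cst|exact: cvg_id].
Qed.

(** Substitution along the decreasing map x |-> k/x on compact segments, followed by monotone
    exhaustion of the half-line. *)
Lemma integral_inversion (k : R) (G : R -> R) : 0 < k ->
  (forall x, 0 < x -> 0 <= G x) -> (forall x, 0 < x -> {for x, continuous G}) ->
  (\int[mu]_(x in `]0%R, +oo[) (G x)%:E =
   \int[mu]_(x in `]0%R, +oo[) (G (k / x) * (k / x ^+ 2))%:E)%E.
Proof.
move=> k0 G0 cG.
pose F x := k / x.
have dF (x : R) : 0 < x -> is_derive x 1 F (- (k / x ^+ 2)).
  move=> x0; have xn0 : x != 0 by rewrite gt_eqF.
  have /is_deriveV : is_derive x 1 (@id R) 1 by exact: is_derive_id.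
  move=> /(_ xn0) dV; have := is_deriveZ k dV.
  rewrite (_ : k \*: _ = F); last by apply/funext.
  by move=> h; apply: (is_derive_eq h); rewrite /GRing.scale/= mulr1 mulrN.
have cF (x : R) : 0 < x -> {for x, continuous F}.
  by move=> /dF dFx; apply/differentiable_continuous/derivable1_diffP.
have F'E (x : R) : 0 < x -> F^`()%classic x = - (k / x ^+ 2).
  by move=> /dF dFx; rewrite derive1E; exact: derive_val.
have cq (x : R) : 0 < x -> {for x, continuous (fun y : R => k / y ^+ 2)}.
  move=> x0; apply: continuousM; first exact: cvg_cst.
  apply: continuousV; first by rewrite expf_neq0// gt_eqF.
  exact: exprn_continuous.
have cF' (x : R) : 0 < x -> {for x, continuous F^`()%classic}.
  (* The formula for the derivative is known only at positive points, so continuity is transferred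
     through a neighbourhood of [x]. *)
  move=> x0; rewrite /prop_for /continuous_at F'E//.
  apply: (@cvg_trans _ ((fun x => - (k / x ^+ 2)) x @[x --> x])).
    apply: near_eq_cvg; near=> y; rewrite F'E//; near: y.
    exact: lt_nbhsr.
  exact: (cvgN (cq _ x0)).
pose n1 n : R := n.+1%:R.
have n10 n : 0 < n1 n by rewrite ltr0n.
have n1ge n : 1 <= n1 n by rewrite ler1n.
have n1V n : (n1 n)^-1 <= n1 n by rewrite (le_trans _ (n1ge n))// invf_le1.
(* The segments are matched so that [F] maps [B n] onto [A n], exchanging the endpoints. *)
pose A n := `[(n1 n)^-1, n1 n]%classic.
pose B n := `[k / n1 n, k * n1 n]%classic.
have sub n : (\int[mu]_(x in A n) (G x)%:E =
              \int[mu]_(x in B n) (G (k / x) * (k / x ^+ 2))%:E)%E.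
  have a0 : 0 < k / n1 n by rewrite divr_gt0.
  have b0 : 0 < k * n1 n by rewrite mulr_gt0.
  have ab : k / n1 n <= k * n1 n by rewrite ler_pM2l.
  have Fa : F (k / n1 n) = n1 n by rewrite /F; field; rewrite ?gt_eqF.
  have Fb : F (k * n1 n) = (n1 n)^-1 by rewrite /F; field; rewrite ?gt_eqF.
  have := @integration_by_substitution_decreasing _ F G _ _ ab.
  rewrite Fa Fb => ->.
  - apply: eq_integral => x; rewrite inE/= in_itv/= => /andP[ax _].
    rewrite !fctE F'E ?opprK//; exact: lt_le_trans ax.
  - move=> x y; rewrite !in_itv/= => /andP[ax _] /andP[ay _] xy.
    by rewrite /F ltr_pM2l// ltf_pV2 ?posrE//; exact: lt_le_trans a0 _.
  - move=> x; rewrite in_itv/= => /andP[ax _]; apply: cF'; exact: lt_trans ax.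
  - apply/cvg_ex; eexists; apply: cvg_at_right_filter; exact: cF'.
  - apply/cvg_ex; eexists; apply: cvg_at_left_filter; exact: cF'.
  - split.
    + move=> x; rewrite in_itv/= => /andP[ax _].
      by have dFx := dF _ (lt_trans a0 ax).
    + by apply: cvg_at_right_filter; exact: cF.
    + by apply: cvg_at_left_filter; exact: cF.
  - apply: continuous_in_subspaceT => x; rewrite inE/= in_itv/= => /andP[ax _].
    apply: cG; apply: lt_le_trans ax; by rewrite invr_gt0.
have mono n m : (n <= m)%N -> n1 n <= n1 m by move=> nm; rewrite ler_nat ltnS.
have ndA : nondecreasing_seq A.
  move=> n m nm; rewrite subsetEset => x; rewrite /A/= !in_itv/= => /andP[h1 h2].
  rewrite (le_trans _ h1) ?(le_trans h2)//; first exact: mono.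
  by rewrite lef_pV2 ?posrE// mono.
have ndB : nondecreasing_seq B.
  move=> n m nm; rewrite subsetEset => x; rewrite /B/= !in_itv/= => /andP[h1 h2].
  rewrite (le_trans _ h1) ?(le_trans h2)//.
    by rewrite ler_pM2l// mono.
  by rewrite ler_pM2l// lef_pV2 ?posrE// mono.
have bound (c : R) : exists n, c <= n1 n.
  exists (Num.bound `|c|); rewrite (le_trans (ler_norm _))//.
  by rewrite (le_trans (ltW (archi_boundP _)))// ler_nat.
have UA : \bigcup_n A n = `]0, +oo[%classic.
  apply/seteqP; split=> [x [n _]|x]; rewrite /A/= !in_itv/= andbT.
    by move=> /andP[h _]; apply: lt_le_trans h; rewrite invr_gt0.
  (* A bound on the sum controls both [x] and [x^-1], hence both ends of [A n]. *)
  move=> x0; have [n hn] := bound (x + x^-1); exists n => //.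
  rewrite /A/= in_itv/=; apply/andP; split.
    rewrite -[x]invrK lef_pV2 ?posrE ?invr_gt0//; apply: le_trans hn.
    by rewrite lerDr ltW.
  by apply: le_trans hn; rewrite lerDl invr_ge0 ltW.
have UB : \bigcup_n B n = `]0, +oo[%classic.
  apply/seteqP; split=> [x [n _]|x]; rewrite /B/= !in_itv/= andbT.
    by move=> /andP[h _]; apply: lt_le_trans h; rewrite divr_gt0.
  move=> x0; have [n hn] := bound (x / k + k / x); exists n => //.
  rewrite /B/= in_itv/=; apply/andP; split.
    rewrite ler_pdivrMr// mulrC -ler_pdivrMr//; apply: le_trans hn.
    by rewrite lerDr divr_ge0// ltW.
  rewrite mulrC -ler_pdivrMr//; apply: le_trans hn.
  by rewrite lerDl divr_ge0// ltW.
have op : open (`]0, +oo[%classic : set R) by exact: interval_open.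
have mG : measurable_fun (`]0%R, +oo[%classic : set T) (fun x => (G x)%:E).
  apply/measurable_EFinP; apply: open_continuous_measurable_fun => // x.
  by rewrite inE/= in_itv/= andbT; exact: cG.
have mGF : measurable_fun (`]0%R, +oo[%classic : set T) (fun x => (G (k / x) * (k / x ^+ 2))%:E).
  apply/measurable_EFinP; apply: open_continuous_measurable_fun => // x.
  rewrite inE/= in_itv/= andbT => x0.
  apply: (@continuousM R T (fun x : R => G (k / x)) (fun x : R => k / x ^+ 2)).
    apply: (@continuous_comp _ _ _ F G); first exact: cF.
    by apply: cG; rewrite divr_gt0.
  exact: cq.
have cA : (\int[mu]_(x in A n) (G x)%:E)%E @[n --> \oo] -->
    (\int[mu]_(x in `]0%R, +oo[) (G x)%:E)%E.
  rewrite -UA; apply: ge0_nondecreasing_set_cvg_integral => //.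
  - by move=> n; exact: measurable_itv.
  - by move=> n; apply: measurable_funS mG => //; rewrite -UA; exact: bigcup_sup.
  - move=> n x Anx; rewrite lee_fin; apply: G0.
    have : (\bigcup_n A n) x by exists n.
    by rewrite UA/= in_itv/= andbT.
have cB : (\int[mu]_(x in B n) (G (k / x) * (k / x ^+ 2))%:E)%E @[n --> \oo] -->
    (\int[mu]_(x in `]0%R, +oo[) (G (k / x) * (k / x ^+ 2))%:E)%E.
  rewrite -UB; apply: ge0_nondecreasing_set_cvg_integral => //.
  - by move=> n; exact: measurable_itv.
  - by move=> n; apply: measurable_funS mGF => //; rewrite -UB; exact: bigcup_sup.
  - move=> n x Bnx; rewrite lee_fin.
    have : (\bigcup_n B n) x by exists n.
    rewrite UB/= in_itv/= andbT => x0.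
    by rewrite mulr_ge0 ?divr_ge0 ?exprn_ge0 ?G0 ?divr_gt0// ltW.
rewrite -(cvg_lim _ cA)// -(cvg_lim _ cB)//.
by congr (limn _); apply/funext => n; exact: sub.
Unshelve. all: by end_near. Qed.

Lemma restrict_right_half (f : T * T -> \bar R) (x y : R) :
  ((f \_ rhalf) (x, y) = if (0 < x)%R then f (x, y) else 0)%E.
Proof.
by rewrite patchE; case: ifPn; [rewrite inE/= /right_half/= => ->|
  rewrite notin_setE/= /right_half/= => /negP/negbTE ->].
Qed.

(* The coordinates [(x, t)] with [y = x t]: the inversion [z |-> 1/z^*] fixes
   the slope [t]. *)
Lemma area_integral_slope F : cont_rh F -> (forall p, 0 < p.1 -> 0 <= F p) ->
  (\int[area]_(p in rhalf) (F p)%:E =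
   \int[mu]_t \int[mu]_(x in `]0%R, +oo[) (x * F (x, x * t))%:E)%E.
Proof.
move=> cF F0.
have mF : measurable_fun rhalf ((EFin \o F) : T * T -> \bar R).
  by apply/measurable_EFinP; exact: cont_rh_measurable.
(* The factor [p.1] is the Jacobian of (x, t) |-> (x, x t). *)
pose F1 (p : R * R) := p.1 * F (p.1, p.1 * p.2).
have cF1 : cont_rh F1.
  apply: cont_rhM; first exact: cont_rh_fst.
  apply: (@cont_rh_comp F (fun p => (p.1, p.1 * p.2))).
  - by [].
  - exact: cont_rh_fst.
  - by apply: cont_rhM; [exact: cont_rh_fst|exact: cont_rh_snd].
  - exact: cF.
have mF1 : measurable_fun rhalf ((EFin \o F1) : T * T -> \bar R).
  by apply/measurable_EFinP; exact: cont_rh_measurable.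
have mrh := measurable_right_half.
have F10 p : 0 < p.1 -> 0 <= F1 p by move=> p0; rewrite mulr_ge0 ?F0// ltW.
rewrite integral_mkcond (fubini_tonelli1 _ _ _)/=; last 2 first.
- by have [+ _] := measurable_restrictT ((EFin \o F) : T * T -> \bar R) mrh; apply.
- move=> [x y]; rewrite restrict_right_half; case: ifPn => //= x0.
  by rewrite lee_fin F0.
transitivity (\int[mu]_x \int[mu]_t (((EFin \o F1) : T * T -> \bar R) \_ rhalf) (x, t))%E.
  apply: eq_integral => x _; rewrite /fubini_F.
  under eq_integral do rewrite restrict_right_half.
  under [RHS]eq_integral do rewrite restrict_right_half.
  have [x0|x0] := ltP 0 x; last by [].
  rewrite (@ge0_integral_affine _ x 0)//; last 3 first.
  - by rewrite gt_eqF.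
  - apply/measurable_EFinP; apply: continuous_measurable_fun => y.
    exact: cont_rh_section2.
  - by move=> y _; rewrite lee_fin F0.
  rewrite preimage_setT; apply: eq_integral => y _.
  by rewrite /F1/= addr0 gtr0_norm.
rewrite fubini_tonelli//=; last 2 first.
- by have [+ _] := measurable_restrictT ((EFin \o F1) : T * T -> \bar R) mrh; apply.
- move=> [x y]; rewrite restrict_right_half; case: ifPn => //= x0.
  by rewrite lee_fin F10.
apply: eq_integral => t _; rewrite [RHS]integral_mkcond; apply: eq_integral => x _.
by rewrite restrict_right_half patchE mem_setE in_itv/= andbT.
Qed.

(** The map z |-> 1 / conj z in real coordinates, that is z / |z|^2. *)
Definition plane_inv (p : R * R) : R * R :=
  (p.1 / (p.1 ^+ 2 + p.2 ^+ 2), p.2 / (p.1 ^+ 2 + p.2 ^+ 2)).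

Lemma sqr_sum_gt0 (p : R * R) : 0 < p.1 -> 0 < p.1 ^+ 2 + p.2 ^+ 2.
Proof. by move=> p0; rewrite ltr_pwDl ?sqr_ge0// exprn_gt0. Qed.

Lemma cont_rh_sqr_sumV : cont_rh (fun p => (p.1 ^+ 2 + p.2 ^+ 2)^-1).
Proof.
move=> p p0; apply: continuousV; first by rewrite gt_eqF// sqr_sum_gt0.
exact: (cont_rhD (cont_rhX (n:=2) cont_rh_fst) (cont_rhX (n:=2) cont_rh_snd) p0).
Qed.

Lemma plane_inv_gt0 p : 0 < p.1 -> 0 < (plane_inv p).1.
Proof. by move=> p0; rewrite divr_gt0// sqr_sum_gt0. Qed.

Lemma cont_rh_plane_inv F : cont_rh F -> cont_rh (F \o plane_inv).
Proof.
apply: cont_rh_comp; first exact: plane_inv_gt0.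
  by apply: cont_rhM; [exact: cont_rh_fst|exact: cont_rh_sqr_sumV].
by apply: cont_rhM; [exact: cont_rh_snd|exact: cont_rh_sqr_sumV].
Qed.

(** The factor is the Jacobian |z|^-4. On the ray of slope [t] the map is x |-> k/x with k = 1/(1 +
    t^2), so the one-dimensional inversion applies slope by slope. *)
Lemma area_integral_inv F : cont_rh F -> (forall p, 0 < p.1 -> 0 <= F p) ->
  (\int[area]_(p in rhalf) (F p)%:E =
   \int[area]_(p in rhalf)
     ((p.1 ^+ 2 + p.2 ^+ 2)^-1 ^+ 2 * F (plane_inv p))%:E)%E.
Proof.
move=> cF F0; rewrite area_integral_slope// area_integral_slope; last 2 first.
- apply: cont_rhM; last exact: cont_rh_plane_inv.
  exact: (cont_rhX (n:=2) cont_rh_sqr_sumV).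
- by move=> p p0; rewrite mulr_ge0 ?sqr_ge0// F0// plane_inv_gt0.
apply: eq_integral => t _.
have t0 : 0 < 1 + t ^+ 2 by rewrite ltr_pwDl// sqr_ge0.
rewrite (@integral_inversion (1 + t ^+ 2)^-1) ?invr_gt0//; last 2 first.
- by move=> x x0; rewrite mulr_ge0 ?F0// ltW.
- move=> x x0; apply: continuousM; first exact: cvg_id.
  apply: (@continuous_comp _ _ _ (fun x : R => (x, x * t))); last exact: cF.
  by apply: continuous_pair; [exact: cvg_id|apply: continuousM; [exact: cvg_id|exact: cvg_cst]].
apply: eq_integral => x; rewrite inE/= in_itv/= andbT => x0.
congr EFin; rewrite /plane_inv/=.
have xn0 : x != 0 by rewrite gt_eqF.
have E : x ^+ 2 + (x * t) ^+ 2 = x ^+ 2 * (1 + t ^+ 2) by ring.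
have tn0 : 1 + t ^+ 2 != 0 by rewrite gt_eqF.
have e1 : x / (x ^+ 2 + (x * t) ^+ 2) = (1 + t ^+ 2)^-1 / x.
  by rewrite E; field; rewrite ?xn0 ?tn0.
have e2 : x * t / (x ^+ 2 + (x * t) ^+ 2) = (1 + t ^+ 2)^-1 / x * t.
  by rewrite E; field; rewrite ?xn0 ?tn0.
rewrite e1 e2 E; set f := F _.
by field; rewrite ?xn0 ?tn0.
Qed.

(** A positive value would persist, by continuity, above half of itself on a box of positive
    area. *)
Lemma area_integral_eq0 F : cont_rh F -> (forall p, 0 < p.1 -> 0 <= F p) ->
  (\int[area]_(p in rhalf) (F p)%:E = 0)%E -> forall p, 0 < p.1 -> F p = 0.
Proof.
move=> cF F0 iF0 [x y] xy0; apply/eqP; rewrite eq_le F0// andbT leNgt.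
apply/negP => Fp; set e := F (x, y) / 2.
have e0 : 0 < e by rewrite divr_gt0.
have : \forall q \near (x, y), rhalf q /\ e < F q.
  apply: filterI; first by have := open_right_half; rewrite openE; apply.
  by apply: (cvgr_gt (F (x, y)) (cF _ xy0)); rewrite /e; lra.
case=> -[U V] /= [/nbhs_ballP[r1 /= r10 rU] /nbhs_ballP[r2 /= r20 rV]] UV.
pose B : set (T * T) := `]x - r1, x + r1[%classic `*` `]y - r2, y + r2[%classic.
have mB : measurable B by apply: measurableX; exact: measurable_itv.
have BUV q : B q -> rhalf q /\ e < F q.
  case: q => u v [/=]; rewrite !in_itv/= => uu vv; apply: UV; split.
    by apply: rU; rewrite /ball/= ltr_distlC; lra.
  by apply: rV; rewrite /ball/= ltr_distlC; lra.
have mF : measurable_fun rhalf ((EFin \o F) : T * T -> \bar R).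
  by apply/measurable_EFinP; exact: cont_rh_measurable.
have : (\int[area]_(p in B) e%:E <= \int[area]_(p in rhalf) (F p)%:E)%E.
  apply: (@le_trans _ _ (\int[area]_(p in B) (F p)%:E)%E).
    apply: ge0_le_integral => //.
    - by move=> q _; rewrite lee_fin ltW.
    - by apply: measurable_funS mF => //; [exact: measurable_right_half|move=> q /BUV[]].
    - by move=> q /BUV[_ /ltW]; rewrite lee_fin.
  apply: ge0_subset_integral => //; first exact: measurable_right_half.
  by move=> q /BUV[].
rewrite iF0 integral_cst// leNgt => /negP; apply.
rewrite /B /= product_measure1E//= !lebesgue_measure_itv/= !lte_fin.
rewrite !ltrD2l !gtrN// -!EFinD -!EFinM lte_fin.
by rewrite !mulr_gt0//; lra.
Unshelve. all: by end_near. Qed.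

End RightHalf.

(** * The Bergman space and maximal operators *)

Section BergmanSpace.
Variables (R : realType) (l : nat).
Local Notation T := (measurableTypeR R).
Local Notation area := (@lebesgue_measure R \x @lebesgue_measure R)%E.
Local Notation rhalf := (@right_half R).
Implicit Types (h k f : hfun R) (p : R * R).

Definition reh h p := complex.Re (hext h (p.1 +i* p.2)).
Definition imh h p := complex.Im (hext h (p.1 +i* p.2)).

Lemma hext_continuous h p : analytic_hp h -> 0 < p.1 ->
  {for p, continuous (reh h)} /\ {for p, continuous (imh h)}.
Proof.
case: p => x y ah x0.
have key e : 0 < e -> \forall q \near (x, y),
    Normc.normc (hext h (q.1 +i* q.2) - hext h (x +i* y)) < e.
  move=> e0; have [r r0 hr] := derivable_continuousC (ah (x +i* y) x0) e0.
  have r2 : 0 < r / 2 by rewrite divr_gt0.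
  exists (ball x (r / 2), ball y (r / 2)).
    by split; apply: nbhsx_ballx.
  move=> [u v] [/= xu yv].
  rewrite (_ : u +i* v = (x +i* y) + ((u - x) +i* (v - y))); last first.
    by apply/eqP; rewrite eq_complex/= !subrKC !eqxx.
  apply: hr; apply: le_lt_trans (normc_le_ReIm _) _ => /=.
  move: xu yv; rewrite /ball/= ![`|_ - u|]distrC ![`|_ - v|]distrC.
  by move=> ? ?; lra.
split; apply/cvgrPdist_lt => e e0; have := key _ e0; apply: filterS => q /=.
  by apply: le_lt_trans; rewrite distrC -raddfB; exact: normc_Re.
by apply: le_lt_trans; rewrite distrC -raddfB; exact: normc_Im.
Qed.

Lemma cont_reh h : analytic_hp h -> cont_rh (reh h).
Proof. by move=> ah p p0; have [] := hext_continuous ah p0. Qed.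

Lemma cont_imh h : analytic_hp h -> cont_rh (imh h).
Proof. by move=> ah p p0; have [] := hext_continuous ah p0. Qed.

Definition energy h p := p.1 ^+ l * (reh h p ^+ 2 + imh h p ^+ 2).

Lemma energy_ge0 h p : 0 < p.1 -> 0 <= energy h p.
Proof. by move=> p0; rewrite mulr_ge0 ?exprn_ge0 ?addr_ge0 ?sqr_ge0// ltW. Qed.

Lemma cont_energy h : analytic_hp h -> cont_rh (energy h).
Proof.
move=> ah; apply: cont_rhM; first exact: (cont_rhX (n := l) (@cont_rh_fst R)).
by apply: cont_rhD; apply: cont_rhX; [exact: cont_reh|exact: cont_imh].
Qed.

Lemma measurable_EFin_rh (F : R * R -> R) : cont_rh F ->
  measurable_fun (rhalf : set (T * T)) ((fun p => (F p)%:E) : T * T -> \bar R).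
Proof. by move=> cF; apply/measurable_EFinP; exact: cont_rh_measurable. Qed.

Lemma bergman_normsqE h : bergman_normsq l h =
  ((pi^-1 : R)%:E * \int[area]_(p in rhalf) (energy h p)%:E)%E.
Proof.
congr (_ * _)%E; apply: eq_integral => p _.
by rewrite sqr_normc_ReIm.
Qed.

Lemma bergmanP h : bergman l h <->
  analytic_hp h /\ (\int[area]_(p in rhalf) (energy h p)%:E < +oo)%E.
Proof.
have I0 : (0 <= \int[area]_(p in rhalf) (energy h p)%:E)%E.
  by apply: integral_ge0 => p p0; rewrite lee_fin energy_ge0.
have pi0 : 0 < (pi : R)^-1 by rewrite invr_gt0 pi_gt0.
rewrite /bergman/= bergman_normsqE; split=> -[ah H]; split=> //.
  rewrite ltNge leye_eq; apply/negP => /eqP E; move: H.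
  by rewrite E gt0_muley ?lte_fin// ltxx.
by apply: lte_mul_pinfty => //; rewrite ?lee_fin ltW.
Qed.

Lemma bergman_dotE h k : bergman_dot l h k =
  (pi^-1 * \int[area]_(p in rhalf)
     (p.1 ^+ l * (reh h p * reh k p + imh h p * imh k p))) +i*
  (pi^-1 * \int[area]_(p in rhalf)
     (p.1 ^+ l * (imh h p * reh k p - reh h p * imh k p))).
Proof.
rewrite /bergman_dot /reh /imh; congr (_ +i* _); congr (_ * _);
  apply: eq_Rintegral => p _; congr (_ * _);
  case: (hext h _) => a b; case: (hext k _) => c d /=; ring.
Qed.

Definition reprod h k p := p.1 ^+ l * (reh h p * reh k p + imh h p * imh k p).
Definition improd h k p := p.1 ^+ l * (imh h p * reh k p - reh h p * imh k p).

Lemma cont_reprod h k : analytic_hp h -> analytic_hp k -> cont_rh (reprod h k).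
Proof.
move=> ah ak; apply: cont_rhM; first exact: (cont_rhX (n := l) (@cont_rh_fst R)).
by apply: cont_rhD; apply: cont_rhM;
  [exact: cont_reh|exact: cont_reh|exact: cont_imh|exact: cont_imh].
Qed.

Lemma cont_improd h k : analytic_hp h -> analytic_hp k -> cont_rh (improd h k).
Proof.
move=> ah ak; apply: cont_rhM; first exact: (cont_rhX (n := l) (@cont_rh_fst R)).
rewrite (_ : (fun p => _) = fun p => imh h p * reh k p + (-1) * (reh h p * imh k p)).
  apply: cont_rhD; [|apply: cont_rhM; first exact: cont_rh_cst];
    by apply: cont_rhM; do [exact: cont_reh|exact: cont_imh].
by apply/funext => p; rewrite mulN1r.
Qed.

Lemma energy_integrable h : bergman l h ->
  area.-integrable (rhalf : set (T * T)) (fun p => (energy h p)%:E).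
Proof.
move=> /bergmanP[ah fh]; apply/integrableP; split.
  by apply: measurable_EFin_rh; exact: cont_energy.
apply: le_lt_trans fh; rewrite le_eqVlt; apply/orP; left; apply/eqP.
apply: eq_integral => p; rewrite inE => p0.
by rewrite gee0_abs// lee_fin energy_ge0.
Qed.

Lemma le_energy_integrable (F : R * R -> R) h k : bergman l h -> bergman l k ->
  cont_rh F -> (forall p, 0 < p.1 -> `|F p| <= energy h p + energy k p) ->
  area.-integrable (rhalf : set (T * T)) (fun p => (F p)%:E).
Proof.
move=> bh bk cF Fle.
have mrh := @measurable_right_half R.
apply: (le_integrable mrh _ _ (integrableD mrh (energy_integrable bh) (energy_integrable bk))).
  exact: measurable_EFin_rh.
move=> p p0 /=; rewrite lee_fin (le_trans (Fle _ p0))// ler_norm//.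
Qed.

Lemma cross_le (a b c d : R) :
  `|a * c + b * d| <= a ^+ 2 + b ^+ 2 + (c ^+ 2 + d ^+ 2).
Proof.
have := sqr_ge0 (a + c); have := sqr_ge0 (a - c).
have := sqr_ge0 (b + d); have := sqr_ge0 (b - d).
have := sqr_ge0 a; have := sqr_ge0 b; have := sqr_ge0 c; have := sqr_ge0 d.
by move=> *; rewrite ler_norml; apply/andP; split; nra.
Qed.

Lemma reprod_integrable h k : bergman l h -> bergman l k ->
  area.-integrable (rhalf : set (T * T)) (fun p => (reprod h k p)%:E).
Proof.
move=> bh bk; apply: (le_energy_integrable bh bk).
  by apply: cont_reprod; [case: bh|case: bk].
move=> p p0; have pl : 0 < p.1 ^+ l by rewrite exprn_gt0.
by rewrite /reprod /energy -[leRHS]mulrDr normrM gtr0_norm// ler_pM2l// cross_le.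
Qed.

Lemma improd_integrable h k : bergman l h -> bergman l k ->
  area.-integrable (rhalf : set (T * T)) (fun p => (improd h k p)%:E).
Proof.
move=> bh bk; apply: (le_energy_integrable bh bk).
  by apply: cont_improd; [case: bh|case: bk].
move=> p p0; have pl : 0 < p.1 ^+ l by rewrite exprn_gt0.
rewrite /improd /energy -[leRHS]mulrDr normrM gtr0_norm// ler_pM2l//.
(* Replacing h by -ih turns the imaginary part of the product into a real part. *)
have := cross_le (imh h p) (- reh h p) (reh k p) (imh k p).
by rewrite mulNr sqrrN [imh h p ^+ 2 + _]addrC.
Qed.

Lemma hext_lin (a : R[i]) h k z : 0 < complex.Re z ->
  hext (fun w => a * h w + k w) z = a * hext h z + hext k z.
Proof. by move=> z0; rewrite !(hextE _ z0). Qed.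

Lemma bergman_lin (a : R[i]) h k : bergman l h -> bergman l k ->
  bergman l (fun z => a * h z + k z).
Proof.
move=> bh bk; have ahk : analytic_hp (fun z => a * h z + k z).
  by apply: analytic_lin; [case: bh|case: bk].
apply/bergmanP; split=> //.
have mrh := @measurable_right_half R.
pose c := 2 * Normc.normc a ^+ 2.
have : area.-integrable (rhalf : set (T * T))
    (fun p => c%:E * (energy h p)%:E + 2%:E * (energy k p)%:E)%E.
  by apply: integrableD => //; apply: integrableZl => //; exact: energy_integrable.
move=> /integrableP[mE]; apply: le_lt_trans; apply: ge0_le_integral => //.
- by move=> p p0; rewrite lee_fin energy_ge0.
- by apply: measurable_EFin_rh; exact: cont_energy.
- exact: measurableT_comp.
- move=> p p0; rewrite gee0_abs; last first.
    by rewrite -!EFinM -EFinD lee_fin addr_ge0// mulr_ge0 ?energy_ge0// /c mulr_ge0 ?sqr_ge0.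
  rewrite -!EFinM -EFinD lee_fin /energy [c * _]mulrCA [2 * _]mulrCA -mulrDr.
  rewrite ler_pM2l ?exprn_gt0// /reh /imh hext_lin// /c sqr_normc_ReIm.
  case: a {c ahk mE} => a b; case: (hext h _) => u v; case: (hext k _) => s t /=.
  (* Parallelogram identity: the difference is |a h - k|^2. *)
  rewrite -subr_ge0.
  rewrite (_ : _ - _ = (a * u - b * v - s) ^+ 2 + (a * v + b * u - t) ^+ 2).
    by rewrite addr_ge0 ?sqr_ge0.
  by ring.
Qed.

Lemma bergman0 : bergman l (fun _ : halfplane R => 0).
Proof.
apply/bergmanP; split; first exact: analytic0.
rewrite (eq_integral (cst 0%E)) ?integral0// => p /set_mem p0.
by rewrite /energy /reh /imh (hextE _ (p0 : 0 < complex.Re (p.1 +i* p.2)))/= expr0n addr0 mulr0.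
Qed.

Lemma bergman_scale (a : R[i]) h : bergman l h -> bergman l (fun z => a * h z).
Proof.
move=> bh; have := bergman_lin a bh bergman0.
by congr bergman; apply/funext => z; rewrite addr0.
Qed.

Lemma bergman_norm0 : bergman_norm l (fun _ : halfplane R => 0) = 0.
Proof.
rewrite /bergman_norm bergman_normsqE (eq_integral (cst 0%E)) ?integral0 ?mule0 ?sqrtr0//.
move=> p /set_mem p0.
by rewrite /energy /reh /imh (hextE _ (p0 : 0 < complex.Re (p.1 +i* p.2)))/= expr0n addr0 mulr0.
Qed.

(** Testing against f1 - f2 makes its energy vanish, and a continuous nonnegative energy of integral
    0 is 0 everywhere. The real part of the equality suffices. *)
Lemma bergman_dot_nondegenerate f1 f2 : bergman l f1 -> bergman l f2 ->
  (forall h, bergman l h -> bergman_dot l h f1 = bergman_dot l h f2) -> f1 = f2.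
Proof.
move=> b1 b2 H.
pose h := (fun z => -1 * f2 z + f1 z) : hfun R.
have bh : bergman l h by exact: bergman_lin.
have mrh := @measurable_right_half R.
have hE p : 0 < p.1 -> reh h p = reh f1 p - reh f2 p /\ imh h p = imh f1 p - imh f2 p.
  move=> p0; rewrite /reh /imh hext_lin// mulN1r !raddfD/= !raddfN/=.
  by rewrite ![- _ + _]addrC.
have := H h bh; rewrite !bergman_dotE => -[] /(mulfI _) + _.
rewrite invr_eq0 gt_eqF ?pi_gt0// => /(_ isT) E.
have I0 : \int[area]_(p in rhalf) (energy h p) = 0.
  transitivity (\int[area]_(p in rhalf) (reprod h f1 p - reprod h f2 p)).
    apply: eq_Rintegral => p /set_mem p0; rewrite /energy /reprod.
    by have [-> ->] := hE p p0; ring.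
  rewrite RintegralB//; [|exact: reprod_integrable|exact: reprod_integrable].
  by rewrite /reprod E subrr.
have {}I0 : (\int[area]_(p in rhalf) (energy h p)%:E = 0)%E.
  rewrite -[LHS]fineK; last by apply: integrable_fin_num => //; exact: energy_integrable.
  by rewrite -[X in X%:E]/(\int[area]_(p in rhalf) (energy h p)) I0.
have ah : analytic_hp h by case: bh.
have Z := area_integral_eq0 (cont_energy ah) (@energy_ge0 h) I0.
apply/funext => z; apply/esym/eqP; rewrite -subr_eq0.
have z0 := valP z.
pose p := (complex.Re (val z), complex.Im (val z)).
have pz : p.1 +i* p.2 = val z by rewrite /p/=; case: (val z).
have := Z p z0; rewrite /energy => /eqP; rewrite mulf_eq0 expf_eq0 gt_eqF// andbF/=.
rewrite paddr_eq0 ?sqr_ge0// !sqrf_eq0 /reh /imh pz hext_val => /andP[/eqP hr /eqP hi].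
rewrite (_ : f2 z - f1 z = - h z); last by rewrite /h mulN1r opprD opprK.
by rewrite oppr_eq0; apply/eqP; move: hr hi; case: (h z) => ? ? /= -> ->.
Qed.

End BergmanSpace.

(** * Maximal operators that are everywhere defined *)

Section MaximalOperators.
Variables (R : realType) (l : nat).
Implicit Types (h k f : hfun R) (F G K : hfun R -> hfun R).

(** [G] supplies a value of the adjoint at every vector; nondegeneracy, tested on the full domain of
    [F], shows that it is the only one. *)
Lemma adjoint_maximal F G :
  (forall h, bergman l h -> bergman l (F h)) ->
  (forall h, bergman l h -> bergman l (G h)) ->
  (forall h f, bergman l h -> bergman l f ->
     bergman_dot l (F h) f = bergman_dot l h (G f)) ->
  adjoint l (maximal_operator l F) = maximal_operator l G.
Proof.
move=> bF bG FG; apply/seteqP; split=> -[f f'] [/= bf bf' E]; split=> //=.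
- apply: (bergman_dot_nondegenerate (l := l)) => // [|h bh]; first exact: bG.
  by rewrite -FG//; apply/esym/E; split=> //; exact: bF.
- by move=> h k [/= bh bk ->]; rewrite E FG.
Qed.

Lemma comp_maximal F G :
  (forall h, bergman l h -> bergman l (G h)) ->
  comp_operator (maximal_operator l F) (maximal_operator l G) =
  maximal_operator l (F \o G).
Proof.
move=> bG; apply/seteqP; split=> -[h k] /=.
  by move=> [u [/= bh bu uE] [/= _ bk kE]]; split=> //=; rewrite kE uE.
move=> [/= bh bk kE]; exists (G h); split=> //=; exact: bG.
Qed.

Lemma eq_maximal F G : (forall h, bergman l h -> F h = G h) ->
  maximal_operator l F = maximal_operator l G.
Proof.
by move=> FG; apply/seteqP; split=> -[h k] [/= bh bk kE]; split=> //=;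
  rewrite kE FG.
Qed.

(** Reduces symmetry to statements about functions: stability of the Bergman space, [G] adjoint to
    [F], [K] an antilinear norm-preserving involution, and the identity K G K = F. *)
Lemma maximal_symmetric F G K :
  (forall h, bergman l h -> bergman l (F h)) ->
  (forall h, bergman l h -> bergman l (G h)) ->
  (forall h, bergman l h -> bergman l (K h)) ->
  (forall a h k, F (fun z => a * h z + k z) = (fun z => a * F h z + F k z)) ->
  (forall a h k, K (fun z => a * h z + k z) = (fun z => a^*%C * K h z + K k z)) ->
  (forall h, bergman l h -> K (K h) = h) ->
  (forall h, bergman l h -> bergman_normsq l (K h) = bergman_normsq l h) ->
  (forall h f, bergman l h -> bergman l f ->
     bergman_dot l (F h) f = bergman_dot l h (G f)) ->
  (forall h, bergman l h -> K (G (K h)) = F h) ->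
  symmetric_wrt l (maximal_operator l K) (maximal_operator l F).
Proof.
move=> bF bG bK linF linK KK nK FG KGK; split.
- split; split.
  + by move=> h k [].
  + by move=> h k1 k2 [/= _ _ ->] [/= _ _ ->].
  + apply/seteqP; split=> [h [k []]//|h bh]; exists (K h); split=> //=; exact: bK.
  + move=> a h1 k1 h2 k2 [/= bh1 bk1 ->] [/= bh2 bk2 ->].
    by split=> /=; [exact: bergman_lin|apply: bergman_lin; exact: bK|rewrite linK].
  + by move=> h k [/= bh bk ->]; rewrite /bergman_norm nK.
  + rewrite comp_maximal//; apply/seteqP; split=> -[h k] /=.
      by move=> [/= bh bk ->]; split=> //=; rewrite KK.
    by move=> [/= bh <-]; split=> //=; rewrite KK.
- split.
  + by move=> h k [].
  + by move=> h k1 k2 [/= _ _ ->] [/= _ _ ->].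
  + split=> /=; [exact: bergman0|exact: bergman0|].
    (* Linearity at zero vectors with scalar -1 gives F 0 = - F 0 + F 0, which is 0. *)
    have E := linF (-1) (fun=> 0) (fun=> 0).
    have : F (fun=> 0) = (fun z => -1 * F (fun=> 0) z + F (fun=> 0) z).
      by rewrite -E; congr F; apply/funext => z; rewrite mulr0 addr0.
    by move=> ->; apply/funext => z; rewrite mulN1r addNr.
  + move=> a h1 k1 h2 k2 [/= bh1 bk1 ->] [/= bh2 bk2 ->].
    by split=> /=; [exact: bergman_lin|apply: bergman_lin; exact: bF|rewrite linF].
(* The domain is the whole space, so [h] approximates itself. *)
- move=> h bh e e0; exists h; first by exists (F h); split=> //=; exact: bF.
  rewrite (_ : (fun z => h z - h z) = fun=> 0) ?bergman_norm0//.
  by apply/funext => z; rewrite subrr.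
- rewrite (adjoint_maximal bF bG FG) comp_maximal// comp_maximal//; last first.
    by move=> h bh; apply: bG; exact: bK.
  by apply: eq_maximal => h bh /=; rewrite KGK.
Qed.

End MaximalOperators.

(** * Composition with affine maps and the conjugations *)

Section AffineMaps.
Variables (R : realType) (l : nat).
Local Notation T := (measurableTypeR R).
Local Notation area := (@lebesgue_measure R \x @lebesgue_measure R)%E.
Local Notation rhalf := (@right_half R).
Local Notation hp := (halfplane R).
Implicit Types (h k f : hfun R) (p : R * R) (g : hp -> hp) (m : R) (w : R[i]).

Lemma imagE (c : R) : ('i * c%:C)%R = 0 +i* c.
Proof.
rewrite -complexiE; apply/eqP; rewrite eq_complex/=.
by apply/andP; split; apply/eqP; ring.
Qed.

(** A relation rather than a construction, so that the results apply to any self-map given by this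
    formula, whatever its proof of positivity. *)
Definition affine_map g m w := forall z : hp, val (g z) = m%:C * val z + w.

Lemma hp_affine_subproof m w (m0 : 0 < m) (w00 : 0 <= complex.Re w) (z : hp) :
  0 < complex.Re (m%:C * val z + w).
Proof.
case: z w w00 => -[x y] /= x0 [a b] /= a0.
by rewrite mul0r subr0 ltr_pwDl// mulr_gt0.
Qed.

Definition hp_affine m w (m0 : 0 < m) (w00 : 0 <= complex.Re w) (z : hp) : hp :=
  exist _ (m%:C * val z + w) (hp_affine_subproof m0 w00 z).

Lemma affine_map_shift (c : R) : affine_map (hp_shift c) 1 (0 +i* c).
Proof. by move=> w; rewrite /= imagE mul1r. Qed.

Lemma derivable_affineC (a b z : R[i]) :
  derivable ((fun z => a * z + b) : (R[i])^o -> (R[i])^o) z 1.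
Proof.
apply/derivableCP; exists a => e e0; exists 1 => // v _.
rewrite (_ : _ - _ = 0) ?Normc.normc0 ?mulr_ge0 ?normc_ge0 ?ltW//.
by rewrite mulrDr; ring.
Qed.

Lemma analytic_affine h g m w : affine_map g m w -> analytic_hp h ->
  analytic_hp (h \o g).
Proof.
move=> gE ah.
apply: (@analytic_comp _ h g ((fun z => m%:C * z + w) : (R[i])^o -> (R[i])^o)).
- exact: ah.
- exact: gE.
- by move=> z _; exact: derivable_affineC.
Qed.

Lemma hext_affine h g m w p : affine_map g m w -> 0 < p.1 ->
  hext (h \o g) (p.1 +i* p.2) =
  hext h ((m * p.1 + complex.Re w) +i* (m * p.2 + complex.Im w)).
Proof.
move=> gE p0; rewrite (hextE (h \o g) (p0 : 0 < complex.Re (p.1 +i* p.2)))/=.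
rewrite -hext_val gE/=; congr (hext h _).
case: w {gE} => a b /=; apply/eqP; rewrite eq_complex/=.
by apply/andP; split; apply/eqP; ring.
Qed.

Lemma reh_affine h g m w p : affine_map g m w -> 0 < p.1 ->
  reh (h \o g) p = reh h (plane_affine m (complex.Re w) m (complex.Im w) p).
Proof. by move=> gE p0; rewrite /reh (hext_affine _ gE). Qed.

Lemma imh_affine h g m w p : affine_map g m w -> 0 < p.1 ->
  imh (h \o g) p = imh h (plane_affine m (complex.Re w) m (complex.Im w) p).
Proof. by move=> gE p0; rewrite /imh (hext_affine _ gE). Qed.

(** After the change of variables the integral runs over Re z > Re w with weight ((x - Re w)/m)^l.
    This is at most (x/m)^l, and enlarging the domain to the half-plane leaves m^-(l+2) times the
    energy of [h]. *)
Lemma bergman_affine h g m w : 0 < m -> 0 <= complex.Re w ->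
  affine_map g m w -> bergman l h -> bergman l (h \o g).
Proof.
move=> m0 w00 gE bh; have ah : analytic_hp h by case: bh.
apply/bergmanP; split; first exact: analytic_affine gE ah.
set x0 := complex.Re w in w00 *; set y0 := complex.Im w.
pose D : set (T * T) := (fun p => (p.1 - x0, p.2) : R * R) @^-1` rhalf.
have DE : D = `]x0, +oo[%classic `*` setT.
  by apply/seteqP; split=> [[x y]|[x y] []] /=;
    rewrite /D/= /right_half/= in_itv/= andbT subr_gt0.
have mD : measurable D by rewrite DE; apply: measurableX => //; exact: measurable_itv.
have Drh : D `<=` rhalf.
  by move=> p; rewrite /D/= /right_half/= subr_gt0; exact: le_lt_trans.
have mrh := @measurable_right_half R.
(* The integrand transported to the image [D] of the half-plane; [(m ^+ 2)^-1] is the Jacobian. *)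
pose F p := (m ^+ 2)^-1 * (((p.1 - x0) / m) ^+ l * (reh h p ^+ 2 + imh h p ^+ 2)).
have cF : cont_rh F.
  apply: cont_rhM; first exact: cont_rh_cst.
  apply: cont_rhM.
    apply: cont_rhX; apply: cont_rhM; last exact: cont_rh_cst.
    by apply: cont_rhD; [exact: cont_rh_fst|exact: cont_rh_cst].
  by apply: cont_rhD; apply: cont_rhX; [exact: cont_reh|exact: cont_imh].
have mF : measurable_fun D ((fun p => (F p)%:E) : T * T -> \bar R).
  by apply: (measurable_funS mrh) => //; exact: measurable_EFin_rh.
have F0 p : D p -> (0 <= (F p)%:E)%E.
  rewrite /D/= /right_half/= => Dp; rewrite lee_fin mulr_ge0 ?invr_ge0 ?sqr_ge0//.
  by rewrite mulr_ge0 ?addr_ge0 ?sqr_ge0// exprn_ge0// divr_ge0// ltW.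
have -> : (\int[area]_(p in rhalf) (energy l (h \o g) p)%:E =
    \int[area]_(p in D) (F p)%:E)%E.
  rewrite [RHS](@ge0_area_integral_affine _ m x0 m y0 _ rhalf)// ?gt_eqF//; last first.
    by apply/seteqP; split=> [[x y]|[x y]]; rewrite /D /plane_affine /right_half/= addrK pmulr_rgt0.
  apply: eq_integral => p /set_mem p0; rewrite -EFinM; congr EFin.
  rewrite /energy (reh_affine _ gE)// (imh_affine _ gE)// /F.
  rewrite gtr0_norm ?mulr_gt0//= -/x0 -/y0 addrK.
  have -> : m * p.1 / m = p.1 by field; rewrite gt_eqF.
  by field; rewrite gt_eqF.
apply: (@le_lt_trans _ _ (\int[area]_(p in rhalf)
    (((m ^+ 2)^-1 * (m ^+ l)^-1)%:E * (energy l h p)%:E))%E).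
  apply: (@le_trans _ _ (\int[area]_(p in D)
    (((m ^+ 2)^-1 * (m ^+ l)^-1)%:E * (energy l h p)%:E))%E).
    apply: ge0_le_integral => //.
    - apply: measurable_funeM; apply: (measurable_funS mrh) => //.
      by apply: measurable_EFin_rh; exact: cont_energy.
    - move=> p Dp; rewrite -EFinM lee_fin /F -mulrA ler_pM2l ?invr_gt0 ?exprn_gt0//.
      rewrite /energy mulrA ler_wpM2r ?addr_ge0 ?sqr_ge0//.
      move: Dp; rewrite /D/= /right_half/= => Dp.
      rewrite exprMn exprVn mulrC ler_pM2l ?invr_gt0 ?exprn_gt0//.
      by apply: lerXn2r; rewrite ?nnegrE; lra.
  apply: ge0_subset_integral => //.
    by apply: measurable_funeM; apply: measurable_EFin_rh; exact: cont_energy.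
  move=> p p0; rewrite -EFinM lee_fin mulr_ge0 ?energy_ge0//.
  by rewrite mulr_ge0 ?invr_ge0 ?exprn_ge0// ltW.
have /integrableP[_] : area.-integrable (rhalf : set (T * T))
    (fun p => ((m ^+ 2)^-1 * (m ^+ l)^-1)%:E * (energy l h p)%:E)%E.
  by apply: integrableZl => //; exact: energy_integrable.
apply: le_lt_trans; rewrite le_eqVlt; apply/orP; left; apply/eqP.
apply: eq_integral => p /set_mem p0; rewrite gee0_abs//.
rewrite -EFinM lee_fin mulr_ge0 ?energy_ge0//.
by rewrite mulr_ge0 ?invr_ge0 ?exprn_ge0// ltW.
Qed.

(** The translation part is vertical, so the half-plane is preserved and the weight only rescales:
    m^-2 from the area and m^-l from the weight. *)
Lemma bergman_dot_dilation h f g g' m (y0 : R) : 0 < m ->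
  bergman l h -> bergman l f ->
  affine_map g m (0 +i* y0) -> affine_map g' m^-1 (0 +i* (- (y0 / m))) ->
  bergman_dot l (h \o g) f =
  bergman_dot l h (fun z => (m^-1 ^+ l.+2)%:C * f (g' z)).
Proof.
move=> m0 bh bf gE g'E; have ah : analytic_hp h by case: bh.
have mn0 : m != 0 by rewrite gt_eqF.
have bfg' : bergman l (f \o g').
  by apply: bergman_affine g'E bf => //; rewrite invr_gt0.
pose k : hfun R := fun z => (m^-1 ^+ l.+2)%:C * f (g' z).
have bk : bergman l k by exact: bergman_scale.
have ak : analytic_hp k by case: bk.
have kE p : 0 < p.1 ->
    reh k (plane_affine m 0 m y0 p) = m^-1 ^+ l.+2 * reh f p /\
    imh k (plane_affine m 0 m y0 p) = m^-1 ^+ l.+2 * imh f p.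
  move=> p0; have q0 : 0 < (plane_affine m 0 m y0 p).1 by rewrite /= addr0 mulr_gt0.
  have E : hext k ((plane_affine m 0 m y0 p).1 +i* (plane_affine m 0 m y0 p).2) =
      (m^-1 ^+ l.+2)%:C * hext f (p.1 +i* p.2).
    rewrite (hextE k (q0 : 0 < complex.Re (_ +i* _))) /k; congr (_ * _).
    rewrite -hext_val g'E/=; congr hext; apply/eqP; rewrite eq_complex/=.
    by apply/andP; split; apply/eqP; field.
  rewrite /reh /imh E; case: (hext f _) => u v /=.
  by rewrite !mul0r subr0 addr0.
have preim : plane_affine m 0 m y0 @^-1` rhalf = rhalf.
  by apply/seteqP; split=> [[x y]|[x y]];
    rewrite /plane_affine /right_half/= addr0 pmulr_rgt0.
have mrh := @measurable_right_half R.
rewrite !bergman_dotE; congr (_ +i* _); congr (_ * _).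
  rewrite /Rintegral [in RHS](@area_integral_affine _ m 0 m y0 _ rhalf)//; last first.
    by apply: (measurable_EFin_rh (F := reprod l h k)); exact: cont_reprod.
  congr fine; apply: eq_integral => p /set_mem p0.
  have [-> ->] := kE p p0.
  rewrite (reh_affine _ gE)// (imh_affine _ gE)// -EFinM; congr EFin.
  rewrite gtr0_norm ?mulr_gt0//= addr0 exprMn !exprS exprVn.
  by field; rewrite expf_neq0.
rewrite /Rintegral [in RHS](@area_integral_affine _ m 0 m y0 _ rhalf)//; last first.
  by apply: (measurable_EFin_rh (F := improd l h k)); exact: cont_improd.
congr fine; apply: eq_integral => p /set_mem p0.
have [-> ->] := kE p p0.
rewrite (reh_affine _ gE)// (imh_affine _ gE)// -EFinM; congr EFin.
rewrite gtr0_norm ?mulr_gt0//= addr0 exprMn !exprS exprVn.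
by field; rewrite expf_neq0.
Qed.

Lemma bergman_dot_translation h f g g' (y0 : R) :
  bergman l h -> bergman l f ->
  affine_map g 1 (0 +i* y0) -> affine_map g' 1 (0 +i* (- y0)) ->
  bergman_dot l (h \o g) f = bergman_dot l h (f \o g').
Proof.
move=> bh bf gE g'E.
rewrite (bergman_dot_dilation (g' := g') ltr01 bh bf gE).
  by congr bergman_dot; apply/funext => z; rewrite invr1 expr1n mul1r.
by rewrite !invr1 mulr1.
Qed.

Lemma bergman_normsq_translation h g (y0 : R) : bergman l h ->
  affine_map g 1 (0 +i* y0) -> bergman_normsq l (h \o g) = bergman_normsq l h.
Proof.
move=> bh gE; have ah : analytic_hp h by case: bh.
have mrh := @measurable_right_half R.
rewrite !bergman_normsqE; congr (_ * _)%E.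
rewrite [RHS](@ge0_area_integral_affine _ 1 0 1 y0 _ rhalf) ?oner_eq0//; last 3 first.
- by apply/seteqP; split=> [[x y]|[x y]];
    rewrite /plane_affine /right_half/= addr0 mul1r.
- by apply: measurable_EFin_rh; exact: cont_energy.
- by move=> p p0; rewrite lee_fin energy_ge0.
apply: eq_integral => p /set_mem p0; rewrite mulr1 normr1 mul1e.
by rewrite /energy (reh_affine _ gE)// (imh_affine _ gE)//= mul1r addr0.
Qed.

End AffineMaps.

(** * The conjugations as maps of functions *)

Section Conjugations.
Variables (R : realType) (l : nat).
Local Notation T := (measurableTypeR R).
Local Notation area := (@lebesgue_measure R \x @lebesgue_measure R)%E.
Local Notation rhalf := (@right_half R).
Local Notation hp := (halfplane R).
Implicit Types (h k f : hfun R) (p : R * R).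

Definition Kshift (a : R) h : hfun R := fun z => ((h (hp_conj_shift a z))^*)%C.

Definition Kstar h : hfun R :=
  fun z => 1 / val z ^+ l.+2 * (h (hp_conj_inv z))^*.

Lemma bergman_normsq_eq h k : analytic_hp k ->
  bergman_normsq l k = bergman_normsq l h -> bergman l h -> bergman l k.
Proof. by move=> ak E [ah]; rewrite -E. Qed.

(** With f(w) = conj (h (conj w)), which is analytic, the function is f(z - ia). *)
Lemma analytic_Kshift (a : R) h : analytic_hp h -> analytic_hp (Kshift a h).
Proof.
move=> ah.
apply: (@analytic_hpP _ _ ((fun w => (hext h w^*%C)^*%C) \o
  (id - cst ((0 +i* a) : (R[i])^o)))) => [z|z z0].
  rewrite /Kshift -hext_val /=; congr (conjc (hext h _)).
  rewrite imagE conjCE !fctE; case: (val z) => x y /=; apply/eqP.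
  by rewrite eq_complex/= opprB addr0 subr0 addrC !eqxx.
apply: derivable_comp1; first exact: derivableB.
apply: derivable_hext_conj => //.
by rewrite !fctE raddfB/= subr0.
Qed.

Lemma bergman_normsq_Kshift (a : R) h : bergman l h ->
  bergman_normsq l (Kshift a h) = bergman_normsq l h.
Proof.
move=> bh; have ah : analytic_hp h by case: bh.
have mrh := @measurable_right_half R.
rewrite !bergman_normsqE; congr (_ * _)%E.
rewrite [RHS](@ge0_area_integral_affine _ 1 0 (-1) a _ rhalf) ?oppr_eq0 ?oner_eq0//; last 3 first.
- by apply/seteqP; split=> [[x y]|[x y]];
    rewrite /plane_affine /right_half/= addr0 mul1r.
- by apply: measurable_EFin_rh; exact: cont_energy.
- by move=> p p0; rewrite lee_fin energy_ge0.
apply: eq_integral => p /set_mem p0; rewrite mul1r normrN normr1 mul1e.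
congr EFin; rewrite /energy /= mul1r addr0; congr (_ * _).
rewrite /reh /imh (hextE _ (p0 : 0 < complex.Re (p.1 +i* p.2))) /Kshift -hext_val/=.
have -> : ((p.1 +i* p.2)^* + 'i * a%:C)%R = p.1 +i* (-1 * p.2 + a).
  rewrite imagE conjCE; apply/eqP; rewrite eq_complex/=.
  by apply/andP; split; apply/eqP; ring.
rewrite mul1r addr0.
by case: (hext h _) => u v /=; rewrite sqrrN.
Qed.

Lemma bergman_Kshift (a : R) h : bergman l h -> bergman l (Kshift a h).
Proof.
move=> bh; apply: bergman_normsq_eq (bh); last exact: bergman_normsq_Kshift.
by apply: analytic_Kshift; case: bh.
Qed.

Lemma KshiftK (a : R) h : Kshift a (Kshift a h) = h.
Proof.
apply/funext => z; rewrite /Kshift conjcK; congr h; apply: val_inj => /=.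
rewrite imagE !conjCE; case: (val z) => x y /=; apply/eqP.
by rewrite eq_complex/=; apply/andP; split; apply/eqP; ring.
Qed.

(** With f(w) = conj (h (conj w)), the function is z^-(l+2) f(1/z). *)
Lemma analytic_Kstar h : analytic_hp h -> analytic_hp (Kstar h).
Proof.
move=> ah.
have inv0 (z : R[i]) : 0 < complex.Re z -> 0 < complex.Re z^-1.
  case: z => x y /= x0; rewrite divr_gt0// ltr_pwDl ?sqr_ge0// exprn_gt0//.
have n0 (z : R[i]) : 0 < complex.Re z -> z != 0.
  by case: z => x y /= x0; rewrite eq_complex/= gt_eqF.
have dV (z : R[i]) : 0 < complex.Re z ->
    derivable ((fun w => w^-1) : (R[i])^o -> (R[i])^o) z 1.
  move=> z0; apply: (@derivableV _ _ (id : (R[i])^o -> (R[i])^o)) => //.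
  exact: n0.
apply: (@analytic_hpP _ _ (((fun w => w^-1) : (R[i])^o -> (R[i])^o) ^+ l.+2 *
  ((fun w => (hext h w^*%C)^*%C) \o (fun w => w^-1)))) => [z|z z0].
  transitivity ((val z)^-1 ^+ l.+2 * (hext h ((val z)^-1)^*%C)^*%C).
    by rewrite /Kstar -(hext_val h) /= !div1r exprVn !conjCE conjc_inv.
  by rewrite exprfctE.
apply: derivableM; first by apply: derivableX; exact: dV.
apply: derivable_comp1; first exact: dV.
by apply: derivable_hext_conj => //; exact: inv0.
Qed.

(** Inversion brings |z|^-4 from the area and |z|^(-2l) from the weight; their product is the
    squared modulus of the factor z^-(l+2). *)
Lemma bergman_normsq_Kstar h : bergman l h ->
  bergman_normsq l (Kstar h) = bergman_normsq l h.
Proof.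
move=> bh; have ah : analytic_hp h by case: bh.
rewrite !bergman_normsqE; congr (_ * _)%E.
rewrite [RHS]area_integral_inv; last 2 first.
- exact: cont_energy.
- exact: energy_ge0.
apply: eq_integral => p /set_mem p0; congr EFin.
have s0 := sqr_sum_gt0 p0.
have -> : energy l (Kstar h) p = p.1 ^+ l * Normc.normc (hext (Kstar h) (p.1 +i* p.2)) ^+ 2.
  by rewrite sqr_normc_ReIm.
have -> : energy l h (plane_inv p) = (plane_inv p).1 ^+ l *
    Normc.normc (hext h ((plane_inv p).1 +i* (plane_inv p).2)) ^+ 2.
  by rewrite sqr_normc_ReIm.
rewrite (hextE _ (p0 : 0 < complex.Re (p.1 +i* p.2))) /Kstar Normc.normcM conjCE normcJ.
rewrite -(hext_val h) exprMn [val (hp_conj_inv _)]/=.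
have -> : 1 / (p.1 +i* p.2)^* = (plane_inv p).1 +i* (plane_inv p).2.
  rewrite conjCE /plane_inv div1r; apply/eqP; rewrite eq_complex/= sqrrN.
  by rewrite mulNr opprK !eqxx.
have -> : Normc.normc (1 / (p.1 +i* p.2) ^+ l.+2) ^+ 2 =
    (p.1 ^+ 2 + p.2 ^+ 2)^-1 ^+ l.+2.
  rewrite div1r -exprVn.
  have nX (z : R[i]) n : Normc.normc (z ^+ n) = Normc.normc z ^+ n.
    by elim: n => [|n IH]; rewrite ?expr0 ?Normc.normc1// !exprS Normc.normcM IH.
  have E : Normc.normc (p.1 +i* p.2)^-1 ^+ 2 = (p.1 ^+ 2 + p.2 ^+ 2)^-1.
    by rewrite Normc.normcV exprVn sqr_normc_ReIm.
  by rewrite nX -exprM mulnC exprM E.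
rewrite mulrA [RHS]mulrA; congr (_ * _).
by rewrite /plane_inv/= exprMn !exprS; ring.
Qed.

Lemma bergman_Kstar h : bergman l h -> bergman l (Kstar h).
Proof.
move=> bh; apply: bergman_normsq_eq (bh); last exact: bergman_normsq_Kstar.
by apply: analytic_Kstar; case: bh.
Qed.

Lemma hp_neq0 (z : hp) : val z != 0.
Proof. by case: z => -[x y] /= x0; rewrite eq_complex/= gt_eqF. Qed.

Lemma KstarK h : Kstar (Kstar h) = h.
Proof.
apply/funext => z; rewrite /Kstar/= !conjCE.
have -> : hp_conj_inv (hp_conj_inv z) = z.
  apply: val_inj => /=; rewrite !conjCE !div1r.
  by rewrite -[conjc (conjc _)^-1]/(((val z)^*%C)^-1^*)%C conjc_inv conjcK invrK.
rewrite rmorphM/= conjcK mulrA !div1r conjc_inv rmorphXn/= conjc_inv conjcK.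
by rewrite exprVn invrK mulVf ?mul1r// expf_neq0// hp_neq0.
Qed.

End Conjugations.

(** * Horizontal translations *)

Section HorizontalShift.
Variables (R : realType) (l : nat).
Local Notation T := (measurableTypeR R).
Local Notation mu := (@lebesgue_measure R).
Local Notation area := (@lebesgue_measure R \x @lebesgue_measure R)%E.
Local Notation rhalf := (@right_half R).
Local Notation hp := (halfplane R).
Implicit Types (h k f : hfun R) (p : R * R).

(** Fubini makes almost every vertical section integrable, so lines on which integrability fails may
    be ignored. *)
Lemma eq_area_Rintegral (F G : R * R -> R) :
  area.-integrable (rhalf : set (T * T)) (fun p => (F p)%:E) ->
  area.-integrable (rhalf : set (T * T)) (fun p => (G p)%:E) ->
  (forall x : R, 0 < x -> mu.-integrable setT (fun y => (F (x, y))%:E) ->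
     mu.-integrable setT (fun y => (G (x, y))%:E) ->
     \int[mu]_y F (x, y) = \int[mu]_y G (x, y)) ->
  \int[area]_(p in rhalf) F p = \int[area]_(p in rhalf) G p.
Proof.
move=> iF iG FG; rewrite /Rintegral; congr fine.
have mrh := @measurable_right_half R.
pose f := ((fun p => (F p)%:E) : T * T -> \bar R) \_ rhalf.
pose g := ((fun p => (G p)%:E) : T * T -> \bar R) \_ rhalf.
have iF' : area.-integrable setT f by apply: (iffLR (integrable_mkcond _ mrh)).
have iG' : area.-integrable setT g by apply: (iffLR (integrable_mkcond _ mrh)).
rewrite integral_mkcond [RHS]integral_mkcond.
rewrite -(integral12_prod_meas1 iF') -(integral12_prod_meas1 iG').
have mf := measurable_fubini_F iF'; have mg := measurable_fubini_F iG'.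
apply: ae_eq_integral; [exact: measurableT|exact: mf|exact: mg|].
apply: filterS2 (ae_integrable1 iF') (ae_integrable1 iG') => x ifx igx _.
rewrite /fubini_F.
have [x0|x0] := ltP 0 x; last first.
  by apply: eq_integral => y _; rewrite /f /g !restrict_right_half ltNge x0.
have fE y : f (x, y) = (F (x, y))%:E by rewrite /f restrict_right_half x0.
have gE y : g (x, y) = (G (x, y))%:E by rewrite /g restrict_right_half x0.
have {}ifx : mu.-integrable setT (fun y => (F (x, y))%:E).
  by apply: eq_integrable ifx => // y _; rewrite fE.
have {}igx : mu.-integrable setT (fun y => (G (x, y))%:E).
  by apply: eq_integrable igx => // y _; rewrite gE.
transitivity (\int[mu]_y (F (x, y))%:E)%E.
  by apply: eq_integral => y _; rewrite fE.
transitivity (\int[mu]_y (G (x, y))%:E)%E; last first.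
  by apply: eq_integral => y _; rewrite gE.
rewrite -[LHS]fineK; last exact: integrable_fin_num.
rewrite -[RHS]fineK; last exact: integrable_fin_num.
by congr EFin; exact: FG.
Qed.

(* Real and imaginary parts of [h z * (f (s - z^* ))^*], which is an analytic
   function of [z = p.1 +i* p.2] for [0 < p.1 < s]. *)
Definition crossr h f (s : R) p :=
  reh h p * reh f (s - p.1, p.2) + imh h p * imh f (s - p.1, p.2).
Definition crossi h f (s : R) p :=
  imh h p * reh f (s - p.1, p.2) - reh h p * imh f (s - p.1, p.2).

(** Cauchy-Riemann equations: a complex derivative p + iq gives the real part slopes (p, -q) and the
    imaginary part slopes (q, p). *)
Lemma cross_diff2 h f (s x y : R) : analytic_hp h -> analytic_hp f ->
  0 < x -> x < s -> exists p q : R,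
    diff2 (fun u v => crossr h f s (u, v)) x y p (- q) /\
    diff2 (fun u v => crossi h f s (u, v)) x y q p.
Proof.
move=> ah af x0 xs.
pose H : (R[i])^o -> (R[i])^o := (hext h : (R[i])^o -> (R[i])^o) *
  (((fun w => (hext f w^*%C)^*%C) : (R[i])^o -> (R[i])^o) \o
   (cst (s%:C : (R[i])^o) - id)).
have HE (u v : R) : H (u +i* v) = crossr h f s (u, v) +i* crossi h f s (u, v).
  have -> : H (u +i* v) =
    hext h (u +i* v) * (hext f (s%:C - (u +i* v))^*%C)^*%C by [].
  have -> : ((s%:C - (u +i* v))^*)%C = (s - u) +i* v.
    by apply/eqP; rewrite eq_complex/= sub0r opprK !eqxx.
  rewrite /crossr /crossi /reh /imh/=.
  case: (hext h _) => a b; case: (hext f _) => c d /=.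
  by apply/eqP; rewrite eq_complex/=; apply/andP; split; apply/eqP; ring.
have : derivable H (x +i* y) 1.
  apply: derivableM; first exact: ah.
  apply: derivable_comp1; first exact: derivableB.
  by apply: derivable_hext_conj => //=; rewrite subr_gt0.
move=> /derivableCP[[p q] dH]; exists p, q.
have key e : 0 < e -> exists2 r : R, 0 < r & forall u v,
    `|u - x| < r -> `|v - y| < r ->
    Normc.normc ((crossr h f s (u, v) - crossr h f s (x, y) -
      (p * (u - x) - q * (v - y))) +i* (crossi h f s (u, v) - crossi h f s (x, y) -
      (q * (u - x) + p * (v - y)))) <= e * (`|u - x| + `|v - y|).
  move=> /[dup] e0 /dH[r r0 Hr]; exists (r / 2); first by rewrite divr_gt0.
  move=> u v ux vy.
  have := Hr ((u - x) +i* (v - y)).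
  have nle := normc_le_ReIm ((u - x) +i* (v - y)).
  have lt : Normc.normc ((u - x) +i* (v - y)) < r.
    by apply: le_lt_trans nle _ => /=; lra.
  move=> /(_ lt).
  have -> : x +i* y + ((u - x) +i* (v - y)) = u +i* v.
    by apply/eqP; rewrite eq_complex/= !subrKC !eqxx.
  rewrite !HE => h1.
  apply: le_trans (_ : e * Normc.normc ((u - x) +i* (v - y)) <= _); last first.
    by rewrite ler_pM2l.
  apply: le_trans h1; rewrite le_eqVlt; apply/orP; left; apply/eqP.
  congr Normc.normc; apply/eqP; rewrite eq_complex/=.
  by apply/andP; split; apply/eqP; ring.
split=> e /key[r r0 Hr]; exists r => // u v ux vy.
  apply: le_trans (le_trans (normc_Re _) (Hr _ _ ux vy)).
  rewrite le_eqVlt; apply/orP; left; apply/eqP.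
  by congr (`|_|); rewrite /=; ring.
apply: le_trans (le_trans (normc_Im _) (Hr _ _ ux vy)).
rewrite le_eqVlt; apply/orP; left; apply/eqP.
by congr (`|_|); rewrite /=; ring.
Qed.

Definition strip (a b : R) : set (T * T) := `[a, b]%classic `*` setT.

Lemma measurable_strip (a b : R) : measurable (strip a b).
Proof. by apply: measurableX => //; exact: measurable_itv. Qed.

Lemma strip_rhalf (a b : R) : 0 < a -> strip a b `<=` rhalf.
Proof.
move=> a0 [x y] [/=]; rewrite in_itv/= => /andP[ax _] _.
exact: lt_le_trans ax.
Qed.

(** Tonelli with [y] outermost, together with the measurability in [y]: the form in which
    [strip_transport] takes its hypotheses. *)
Lemma ge0_strip_integral (a b : R) (F : T * T -> \bar R) :
  measurable_fun (strip a b) F -> (forall p, strip a b p -> 0 <= F p)%E ->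
  measurable_fun setT (fun y : T => \int[mu]_(x in `[a, b]) F (x, y))%E /\
  (\int[mu]_y \int[mu]_(x in `[a, b]) F (x, y) = \int[area]_(p in strip a b) F p)%E.
Proof.
move=> mF F0; have mS := measurable_strip a b.
have mF' : measurable_fun setT (F \_ (strip a b)).
  by have [+ _] := measurable_restrictT F mS; apply.
have F0' p : (0 <= (F \_ (strip a b)) p)%E by apply: erestrict_ge0 => q; exact: F0.
have E (y : T) : (\int[mu]_(x in `[a, b]) F (x, y) =
    fubini_G mu (F \_ (strip a b)) y)%E.
  rewrite /fubini_G [LHS]integral_mkcond; apply: eq_integral => x _.
  by rewrite !patchE; congr (if _ then _ else _); apply/idP/idP;
    rewrite !inE /strip/=; [move=> ?; split|case].
split.
  rewrite (_ : (fun y => _) = fubini_G mu (F \_ (strip a b))); last exact/funext.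
  exact: measurable_fun_fubini_tonelli_G.
rewrite [RHS]integral_mkcond (fubini_tonelli2 _ mF' F0').
by apply: eq_integral => y _; rewrite E.
Qed.

(** Away from the boundary the weight is at least a^l, so unweighted densities are controlled
    there. *)
Lemma energy_density_le (a : R) h p : 0 < a -> a <= p.1 ->
  reh h p ^+ 2 + imh h p ^+ 2 <= (a ^+ l)^-1 * energy l h p.
Proof.
move=> a0 ap; rewrite /energy mulrA ler_peMl ?addr_ge0 ?sqr_ge0//.
rewrite mulrC ler_pdivlMr ?exprn_gt0// mul1r.
by apply: lerXn2r => //; rewrite nnegrE; lra.
Qed.

(** The reflection x |-> a + b - x preserves the closed strip, so the integrals of both densities
    are at most a^-l times an energy. *)
Lemma strip_cross_finite (F : R * R -> R) h f (a b : R) :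
  bergman l h -> bergman l f -> 0 < a -> a <= b ->
  (forall p, 0 < p.1 -> p.1 < a + b -> {for p, continuous F}) ->
  (forall p, `|F p| <= (reh h p ^+ 2 + imh h p ^+ 2) +
    (reh f (a + b - p.1, p.2) ^+ 2 + imh f (a + b - p.1, p.2) ^+ 2)) ->
  measurable_fun setT (fun y : R => \int[mu]_(x in `[a, b]) (`|F (x, y)|)%:E)%E /\
  (\int[mu]_y \int[mu]_(x in `[a, b]) (`|F (x, y)|)%:E < +oo)%E.
Proof.
move=> bh bf a0 ab cF Fle.
have ah : analytic_hp h by case: bh.
have af : analytic_hp f by case: bf.
have mS := measurable_strip a b.
have mrh := @measurable_right_half R.
have Srh := @strip_rhalf a b a0.
have mF : measurable_fun (strip a b) (fun p => (`|F p|)%:E).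
  (* Continuity holds only where both the point and its reflection lie in the half-plane; this open
     strip contains the closed one. *)
  pose S : set (R * R) := `]0, (a + b)[%classic `*` setT.
  have oS : open S.
    rewrite openE => -[x y] /= [x0 _].
    exists (`]0, (a + b)[%classic, setT) => /=; last by move=> [].
    split; last exact: filterT.
    by apply: open_nbhs_nbhs; split.
  apply/measurable_EFinP; apply: measurableT_comp => //.
  apply: (@measurable_funS _ _ _ _ S); first exact: open_measurable2.
    by move=> [x y] [/=]; rewrite /S/= !in_itv/= => /andP[? ?] _; split=> //; lra.
  apply: continuous_measurable2 => // p [/=].
  by rewrite in_itv/= => /andP[? ?] _; exact: cF.
have F0 p : strip a b p -> (0 <= (`|F p|)%:E)%E by rewrite lee_fin.
have [m1 E] := ge0_strip_integral mF F0.
split=> //; rewrite E.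
pose c := (a ^+ l)^-1.
pose phi := plane_affine (-1) (a + b) 1 0.
have phiS : phi @^-1` strip a b = strip a b.
  apply/seteqP; split=> [[x y]|[x y]] [/=]; rewrite /phi/= !in_itv/= => /andP[? ?] _;
    by split=> //=; rewrite in_itv/=; apply/andP; split; lra.
have phiE p : phi p = (a + b - p.1, p.2).
  by rewrite /phi /plane_affine mulN1r mul1r addr0 addrC.
have mE k : analytic_hp k -> measurable_fun (strip a b) (fun p => (energy l k p)%:E).
  by move=> ak; apply: (measurable_funS mrh) => //; apply: measurable_EFin_rh; exact: cont_energy.
have fE k : bergman l k -> (\int[area]_(p in strip a b) (energy l k p)%:E < +oo)%E.
  move=> bk; have [ak fk] := (bergmanP l k).1 bk.
  apply: le_lt_trans fk; apply: ge0_subset_integral => //.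
    by apply: measurable_EFin_rh; exact: cont_energy.
  by move=> p p0; rewrite lee_fin energy_ge0.
have c0 : 0 <= c by rewrite /c invr_ge0 exprn_ge0// ltW.
have E0 k p : strip a b p -> (0 <= (energy l k p)%:E)%E.
  by move=> /Srh p0; rewrite lee_fin energy_ge0.
have mphi : measurable_fun (strip a b) (fun p => (energy l f (phi p))%:E).
  apply: (@measurable_comp _ _ _ _ _ _ (strip a b)
    ((fun p => (energy l f p)%:E) : T * T -> \bar R) _ phi) => //.
  - by move=> _ [p Sp <-]; rewrite -phiS in Sp.
  - exact: mE.
  - by apply: (measurable_funS measurableT) => //; exact: measurable_plane_affine.
have E0' p : strip a b p -> (0 <= (energy l f (phi p))%:E)%E.
  by rewrite -{1}phiS; exact: E0.
apply: (@le_lt_trans _ _ (\int[area]_(p in strip a b)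
  (c%:E * ((energy l h p)%:E + (energy l f (phi p))%:E)))%E).
  apply: ge0_le_integral => //.
  - by apply: measurable_funeM; apply: emeasurable_funD => //; exact: mE.
  - move=> p Sp; rewrite -EFinD -EFinM lee_fin (le_trans (Fle p))// mulrDr.
    case: p Sp => x y [/=]; rewrite in_itv/= => /andP[ax xb] _.
    rewrite phiE /= lerD//; apply: energy_density_le => //=; lra.
rewrite ge0_integralZl//; last 2 first.
- by apply: emeasurable_funD => //; exact: mE.
- by move=> p Sp; apply: adde_ge0; [exact: E0|exact: E0'].
apply: lte_mul_pinfty => //.
rewrite ge0_integralD//; [|exact: E0|exact: mE].
apply: lte_add_pinfty; first exact: fE.
have := fE f bf.
rewrite [X in (X < _)%E -> _]
  (@ge0_area_integral_affine _ (-1) (a + b) 1 0 _ _ _ _ _ phiS) ?oppr_eq0 ?oner_eq0//;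
  [|exact: mE|by move=> p; exact: E0].
rewrite -/phi; apply: le_lt_trans; rewrite le_eqVlt; apply/orP; left; apply/eqP.
by apply: eq_integral => p _; rewrite mulr1 normrN1 mul1e.
Qed.

End HorizontalShift.

(** * The adjoint of composition with a translation *)

Section ShiftAdjoint.
Variables (R : realType) (l : nat).
Local Notation T := (measurableTypeR R).
Local Notation mu := (@lebesgue_measure R).
Local Notation area := (@lebesgue_measure R \x @lebesgue_measure R)%E.
Local Notation rhalf := (@right_half R).
Local Notation hp := (halfplane R).
Implicit Types (h k f : hfun R) (p : R * R) (g : hp -> hp).

Lemma continuous_reflect (F : R * R -> R) (s : R) p : cont_rh F -> p.1 < s ->
  {for p, continuous (fun p => F (s - p.1, p.2))}.
Proof.
move=> cF ps; apply: (@continuous_comp _ _ _ (fun p => (s - p.1, p.2))); last first.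
  by apply: cF; rewrite /= subr_gt0.
apply: continuous_pair; last exact: cvg_snd.
by apply: continuousB; [exact: cvg_cst|exact: cvg_fst].
Qed.

Lemma continuous_crossr h f (s : R) p : analytic_hp h -> analytic_hp f ->
  0 < p.1 -> p.1 < s -> {for p, continuous (crossr h f s)}.
Proof.
move=> ah af p0 ps; apply: continuousD; apply: continuousM.
- exact: cont_reh.
- by apply: continuous_reflect ps; exact: cont_reh.
- exact: cont_imh.
- by apply: continuous_reflect ps; exact: cont_imh.
Qed.

Lemma continuous_crossi h f (s : R) p : analytic_hp h -> analytic_hp f ->
  0 < p.1 -> p.1 < s -> {for p, continuous (crossi h f s)}.
Proof.
move=> ah af p0 ps; apply: continuousB; apply: continuousM.
- exact: cont_imh.
- by apply: continuous_reflect ps; exact: cont_reh.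
- exact: cont_reh.
- by apply: continuous_reflect ps; exact: cont_imh.
Qed.

Lemma diff2N (F : R -> R -> R) (x y p q : R) : diff2 F x y p q ->
  diff2 (fun u v => - F u v) x y (- p) (- q).
Proof.
move=> dF e /dF[r r0 Fr]; exists r => // u v ux vy.
apply: le_trans (Fr _ _ ux vy); rewrite -normrN le_eqVlt; apply/orP; left.
by apply/eqP; congr (`|_|); ring.
Qed.

(** For the analytic product H, the closed form is Im (H dz) = Im H dx + Re H dy. *)
Lemma crossr_transport h f (a b : R) : bergman l h -> bergman l f ->
  0 < a -> a <= b ->
  mu.-integrable setT (fun y => (crossr h f (a + b) (a, y))%:E) ->
  mu.-integrable setT (fun y => (crossr h f (a + b) (b, y))%:E) ->
  \int[mu]_y crossr h f (a + b) (b, y) = \int[mu]_y crossr h f (a + b) (a, y).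
Proof.
move=> bh bf a0 ab ia ib.
have ah : analytic_hp h by case: bh.
have af : analytic_hp f by case: bf.
have [mK fK] : measurable_fun setT (fun y : R =>
    \int[mu]_(x in `[a, b]) (`|crossi h f (a + b) (x, y)|)%:E)%E /\
  (\int[mu]_y \int[mu]_(x in `[a, b]) (`|crossi h f (a + b) (x, y)|)%:E < +oo)%E.
  apply: (strip_cross_finite bh bf a0 ab).
    by move=> p p0 ps; exact: continuous_crossi.
  move=> p; have := cross_le (imh h p) (- reh h p)
    (reh f (a + b - p.1, p.2)) (imh f (a + b - p.1, p.2)).
  by rewrite mulNr sqrrN [imh h p ^+ 2 + _]addrC.
apply: (@strip_transport _ (fun u v => crossi h f (a + b) (u, v))
  (fun u v => crossr h f (a + b) (u, v)) a b ab) => //.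
move=> x y /andP[ax xb].
have x0 : 0 < x by exact: lt_le_trans ax.
have xs : x < a + b by lra.
have [p [q [d1 d2]]] := cross_diff2 y ah af x0 xs.
by exists q, p, (- q).
Qed.

(** The companion form is Re (H dz) = Re H dx - Im H dy, which explains the change of sign. *)
Lemma crossi_transport h f (a b : R) : bergman l h -> bergman l f ->
  0 < a -> a <= b ->
  mu.-integrable setT (fun y => (crossi h f (a + b) (a, y))%:E) ->
  mu.-integrable setT (fun y => (crossi h f (a + b) (b, y))%:E) ->
  \int[mu]_y crossi h f (a + b) (b, y) = \int[mu]_y crossi h f (a + b) (a, y).
Proof.
move=> bh bf a0 ab ia ib.
have ah : analytic_hp h by case: bh.
have af : analytic_hp f by case: bf.
have [mK fK] : measurable_fun setT (fun y : R =>
    \int[mu]_(x in `[a, b]) (`|crossr h f (a + b) (x, y)|)%:E)%E /\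
  (\int[mu]_y \int[mu]_(x in `[a, b]) (`|crossr h f (a + b) (x, y)|)%:E < +oo)%E.
  apply: (strip_cross_finite bh bf a0 ab).
    by move=> p p0 ps; exact: continuous_crossr.
  by move=> p; exact: cross_le.
have NN (F : R -> R) : mu.-integrable setT (EFin \o F) ->
    \int[mu]_y (- F y) = - \int[mu]_y F y.
  move=> iF; rewrite -mulN1r -RintegralZl//.
  by apply: eq_Rintegral => y _; rewrite mulN1r.
apply: oppr_inj; rewrite -!NN//.
apply: (@strip_transport _ (fun u v => crossr h f (a + b) (u, v))
  (fun u v => - crossi h f (a + b) (u, v)) a b ab) => //; last 2 first.
- by have := integrableN ia; apply: eq_integrable => // y _.
- by have := integrableN ib; apply: eq_integrable => // y _.
move=> x y /andP[ax xb].
have x0 : 0 < x by exact: lt_le_trans ax.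
have xs : x < a + b by lra.
have [p [q [d1 d2]]] := cross_diff2 y ah af x0 xs.
by exists p, (- q), (- p); split=> //; exact: diff2N.
Qed.

(* The inner products of [h (. + x0)] with [f] and of [h] with [f (. + x0)] agree
   line by line: by Cauchy's theorem the integral of [h (x1 + iy) (f (x2 + iy))^*]
   over [y] depends on [x1 + x2] only. *)
Lemma bergman_dot_shift h f g (x0 : R) : 0 < x0 ->
  bergman l h -> bergman l f -> affine_map g 1 (x0 +i* 0) ->
  bergman_dot l (h \o g) f = bergman_dot l h (f \o g).
Proof.
move=> x00 bh bf gE.
have bhg : bergman l (h \o g) by apply: bergman_affine gE bh => //=; exact: ltW.
have bfg : bergman l (f \o g) by apply: bergman_affine gE bf => //=; exact: ltW.
have sE (k : hfun R) (x y : R) : 0 < x ->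
    reh (k \o g) (x, y) = reh k (x + x0, y) /\ imh (k \o g) (x, y) = imh k (x + x0, y).
  move=> xx; rewrite (reh_affine _ gE)// (imh_affine _ gE)//.
  by rewrite /plane_affine/= !mul1r addr0.
have e1 (x : R) : x + (x + x0) - x = x + x0 by ring.
have e2 (x : R) : x + (x + x0) - (x + x0) = x by ring.
have scale (F G : R -> R) (c : R) : 0 < c -> (forall y, F y = c * G y) ->
    mu.-integrable setT (fun y => (F y)%:E) ->
    mu.-integrable setT (fun y => (G y)%:E) /\
    \int[mu]_y F y = c * \int[mu]_y G y.
  move=> c0 FG iF.
  have iG : mu.-integrable setT (fun y => (G y)%:E).
    have := integrableZl measurableT c^-1 iF; apply: eq_integrable => // y _.
    by rewrite -EFinM FG mulKf// gt_eqF.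
  by split=> //; rewrite -RintegralZl//; apply: eq_Rintegral => y _; rewrite FG.
rewrite !bergman_dotE; congr (_ +i* _); congr (_ * _); apply: eq_area_Rintegral.
- exact: reprod_integrable bhg bf.
- exact: reprod_integrable bh bfg.
- move=> x xx iF iG.
  have xl : 0 < x ^+ l by rewrite exprn_gt0.
  have xx0 : x <= x + x0 by rewrite lerDl ltW.
  (* On the line of abscissa [x] take s = 2x + x0. Then h(x + x0 + iy) is paired with f(x + iy) at
     abscissa [x + x0], and h(x + iy) with f(x + x0 + iy) at [x]; both carry the constant weight
     [x ^+ l]. *)
  have [|iF' ->] := scale _ (fun y => crossr h f (x + (x + x0)) (x + x0, y)) _ xl _ iF.
    by move=> y /=; have [-> ->] := sE h x y xx; rewrite /crossr/= e2.
  have [|iG' ->] := scale _ (fun y => crossr h f (x + (x + x0)) (x, y)) _ xl _ iG.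
    by move=> y /=; have [-> ->] := sE f x y xx; rewrite /crossr/= e1.
  by congr (_ * _); exact: crossr_transport.
- exact: improd_integrable bhg bf.
- exact: improd_integrable bh bfg.
- move=> x xx iF iG.
  have xl : 0 < x ^+ l by rewrite exprn_gt0.
  have xx0 : x <= x + x0 by rewrite lerDl ltW.
  have [|iF' ->] := scale _ (fun y => crossi h f (x + (x + x0)) (x + x0, y)) _ xl _ iF.
    by move=> y /=; have [-> ->] := sE h x y xx; rewrite /crossi/= e2.
  have [|iG' ->] := scale _ (fun y => crossi h f (x + (x + x0)) (x, y)) _ xl _ iG.
    by move=> y /=; have [-> ->] := sE f x y xx; rewrite /crossi/= e1.
  by congr (_ * _); exact: crossi_transport.
Qed.

(** Splits w into its horizontal part, which is its own adjoint, and its vertical part, whose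
    adjoint is the opposite translation; hence conj w. *)
Lemma bergman_dot_comp_shift h f g g' (w : R[i]) : 0 <= complex.Re w ->
  bergman l h -> bergman l f -> affine_map g 1 w -> affine_map g' 1 w^*%C ->
  bergman_dot l (h \o g) f = bergman_dot l h (f \o g').
Proof.
move=> w0 bh bf gE g'E.
pose gx : hp -> hp := hp_affine (w := (complex.Re w) +i* 0) ltr01 w0.
have gxE : affine_map gx 1 (complex.Re w +i* 0) by [].
have gyE := affine_map_shift (complex.Im w).
have gyE' := affine_map_shift (- complex.Im w).
have bhx : bergman l (h \o gx) by exact: bergman_affine gxE bh.
have bfy : bergman l (f \o hp_shift (- complex.Im w)).
  by apply: bergman_affine gyE' bf.
have -> : h \o g = (h \o gx) \o hp_shift (complex.Im w).
  apply/funext => z; congr h; apply: val_inj; rewrite gE gxE gyE.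
  rewrite !mul1r -addrA; congr (_ + _); case: (w) => a b.
  by apply/eqP; rewrite eq_complex/= addr0 add0r !eqxx.
have -> : f \o g' = (f \o hp_shift (- complex.Im w)) \o gx.
  apply/funext => z; congr f; apply: val_inj; rewrite g'E gyE' gxE.
  rewrite !mul1r -addrA; congr (_ + _); case: (w) => a b.
  by apply/eqP; rewrite eq_complex/= addr0 add0r !eqxx.
rewrite (bergman_dot_translation bhx bf gyE gyE').
(* The contour argument is for a strictly positive shift; a zero horizontal part is the identity. *)
have := w0; rewrite le_eqVlt => /predU1P[w00|w00]; last first.
  exact: (bergman_dot_shift w00 bh bfy gxE).
have idE (k : hfun R) : k \o gx = k.
  apply/funext => z; congr k; apply: val_inj; rewrite gxE mul1r -w00.
  by rewrite (_ : 0 +i* 0 = 0)// addr0.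
by rewrite !idE.
Qed.

End ShiftAdjoint.

(** * The three symmetry statements *)

Section Cases.
Variables (R : realType) (l : nat).
Local Notation hp := (halfplane R).
Implicit Types (h k f : hfun R) (g : hp -> hp) (m : R) (w : R[i]).

(** Conjugating the translation by conj w with z |-> conj z + ia gives back the translation by w, as
    the two shifts by [a] cancel. *)
Lemma translation_case g w (a : R) : 0 <= complex.Re w -> affine_map g 1 w ->
  symmetric_wrt l (conj_shift l a) (composition_max l g).
Proof.
move=> w0 gE.
have wJ0 : 0 <= complex.Re w^*%C by case: w w0 {gE}.
pose g' : hp -> hp := hp_affine ltr01 wJ0.
have g'E : affine_map g' 1 w^*%C by [].
apply: (@maximal_symmetric R l _ (fun h => h \o g') (@Kshift R a)).
- by move=> h; exact: bergman_affine gE.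
- by move=> h; exact: bergman_affine g'E.
- exact: bergman_Kshift.
- by [].
- by move=> b h k; apply/funext => z; rewrite /Kshift rmorphD rmorphM.
- by move=> h _; exact: KshiftK.
- exact: bergman_normsq_Kshift.
- by move=> h f bh bf; exact: bergman_dot_comp_shift gE g'E.
- move=> h _; apply/funext => z; rewrite /Kshift/= conjcK; congr h; apply: val_inj.
  rewrite gE /= !imagE !conjCE; case: (val z) (w) => x y [c d].
  by apply/eqP; rewrite eq_complex/=; apply/andP; split; apply/eqP; ring.
Qed.

Definition dilation m (m0 : 0 < m) : hp -> hp := hp_affine (w := 0) m0 (lexx 0).

Lemma dilationE m (m0 : 0 < m) : affine_map (dilation m0) m (0 +i* 0).
Proof. by []. Qed.

(** The adjoint of composition with z |-> m z. *)
Definition dilation_adj m (m0V : 0 < m^-1) h : hfun R :=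
  fun z => (m^-1 ^+ l.+2)%:C * h (dilation m0V z).

Section Dilation.
Variables (m : R) (m0 : 0 < m) (m0V : 0 < m^-1).

Lemma bergman_dilation h : bergman l h -> bergman l (h \o dilation m0).
Proof. exact: bergman_affine (dilationE m0). Qed.

Lemma bergman_dilation_adj h : bergman l h -> bergman l (dilation_adj m0V h).
Proof.
move=> bh; apply: bergman_scale.
exact: (@bergman_affine _ _ h _ _ (0 +i* 0) m0V (lexx 0) (dilationE m0V)).
Qed.

Lemma bergman_dot_dilation_adj h f : bergman l h -> bergman l f ->
  bergman_dot l (h \o dilation m0) f = bergman_dot l h (dilation_adj m0V f).
Proof.
move=> bh bf; apply: (bergman_dot_dilation (y0 := 0)) => //.
by rewrite mul0r oppr0; exact: dilationE.
Qed.

(** Inversion exchanges the dilations by m and 1/m. The powers of z from the two factors cancel, and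
    the remaining m^(l+2) absorbs the constant of the adjoint. *)
Lemma Kstar_dilation h :
  Kstar l (dilation_adj m0V (Kstar l h)) = h \o dilation m0.
Proof.
have mC : m%:C != 0 by rewrite eq_complex/= gt_eqF.
apply/funext => z; have z0 := hp_neq0 z.
rewrite /Kstar /dilation_adj.
set z2 := dilation m0V (hp_conj_inv z).
have z2E : val z2 = (m%:C)^-1 * (val z)^-1^*%C.
  have mVC : (m^-1)%:C = (m%:C)^-1 by exact: (fmorphV (real_complex R)).
  by rewrite /= addr0 conjCE conjc_inv mul1r mVC.
have z2J : ((val z2)^*)%C = (m%:C)^-1 * (val z)^-1.
  rewrite z2E; transitivity (((m%:C)^-1)^*%C * ((val z)^-1^*%C)^*%C).
    exact: rmorphM.
  by rewrite conjcK conjc_inv conjc_real.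
have -> : hp_conj_inv z2 = dilation m0 z.
  apply: val_inj; have -> : val (hp_conj_inv z2) = 1 / (val z2)^*%C by [].
  by rewrite z2J div1r invfM !invrK /= addr0.
set H := h _.
have cJ (a b : R[i]) : ((a * b)^*)%C = a^*%C * b^*%C by exact: rmorphM.
have XJ (a : R[i]) n : ((a ^+ n)^*)%C = a^*%C ^+ n by exact: rmorphXn.
rewrite !conjCE !div1r !cJ conjcK conjc_inv conjc_real XJ z2J.
have -> : (m^-1 ^+ l.+2)%:C = (m%:C)^-1 ^+ l.+2.
  by rewrite (rmorphXn (real_complex R)) (fmorphV (real_complex R)).
rewrite exprMn !exprVn -[RHS]/H.
by field; rewrite !expf_neq0.
Qed.

End Dilation.

Lemma dilation_case g m : 0 < m -> (forall z, val (g z) = m%:C * val z) ->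
  symmetric_wrt l (conj_star l) (composition_max l g).
Proof.
move=> m0 gE; have m0V : 0 < m^-1 by rewrite invr_gt0.
have -> : g = dilation m0.
  by apply/funext => z; apply: val_inj; rewrite gE /= addr0.
apply: (@maximal_symmetric R l _ (dilation_adj m0V) (@Kstar R l)).
- exact: bergman_dilation.
- exact: bergman_dilation_adj.
- exact: bergman_Kstar.
- by [].
- move=> b h k; apply/funext => z; rewrite /Kstar !conjCE rmorphD rmorphM/= mulrDr.
  by rewrite mulrCA.
- by move=> h _; exact: KstarK.
- exact: bergman_normsq_Kstar.
- exact: bergman_dot_dilation_adj.
- by move=> h _; exact: Kstar_dilation.
Qed.

Definition shiftf (c : R) h : hfun R := fun z => h (hp_shift c z).

Lemma shiftfK (c : R) h : shiftf c (shiftf (- c) h) = h.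
Proof.
apply/funext => z; congr h; apply: val_inj; rewrite /= !imagE.
case: (val z) => x y; apply/eqP; rewrite eq_complex/=.
by apply/andP; split; apply/eqP; ring.
Qed.

Lemma shiftNfK (c : R) h : shiftf (- c) (shiftf c h) = h.
Proof. by rewrite -{2}[c]opprK shiftfK. Qed.

Lemma bergman_shiftf (c : R) h : bergman l h -> bergman l (shiftf c h).
Proof. exact: bergman_affine (affine_map_shift c). Qed.

Lemma bergman_normsq_shiftf (c : R) h : bergman l h ->
  bergman_normsq l (shiftf c h) = bergman_normsq l h.
Proof. by move=> bh; exact: bergman_normsq_translation bh (affine_map_shift c). Qed.

Lemma bergman_dot_shiftf (c : R) h f : bergman l h -> bergman l f ->
  bergman_dot l (shiftf c h) f = bergman_dot l h (shiftf (- c) f).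
Proof.
by move=> bh bf; exact: bergman_dot_translation bh bf (affine_map_shift c)
  (affine_map_shift (- c)).
Qed.

(** Vertical translations are unitary, so the adjoint in the definition is the translation by
    [- c]. *)
Lemma conj_star_translatedE (c : R) : conj_star_translated l c =
  maximal_operator l (fun h => shiftf c (Kstar l (shiftf (- c) h))).
Proof.
rewrite /conj_star_translated.
rewrite [translation l c]/(maximal_operator l (shiftf c)).
rewrite [conj_star l]/(maximal_operator l (@Kstar R l)).
rewrite (adjoint_maximal (@bergman_shiftf c) (@bergman_shiftf (- c)) (@bergman_dot_shiftf c)).
rewrite !comp_maximal//; last exact: bergman_shiftf.
by move=> h bh; apply: bergman_Kstar; exact: bergman_shiftf.
Qed.

(** Composition with g is the dilation operator conjugated by the translation by [c]; the inner
    translations cancel and everything reduces to [Kstar_dilation]. *)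
Lemma affine_case g m w (c : R) : 0 < m -> m != 1 -> affine_map g m w ->
  c%:C = ('i * (1 - m%:C)^-1 * w)%R ->
  symmetric_wrt l (conj_star_translated l c) (composition_max l g).
Proof.
move=> m0 m1 gE cE; have m0V : 0 < m^-1 by rewrite invr_gt0.
pose F h := shiftf c (shiftf (- c) h \o dilation m0).
have mC : 1 - m%:C != 0.
  by rewrite subr_eq0 eq_sym; apply: contra m1 => /eqP/complexI ->.
(* Solves the relation defining [c] for w: the point -ic is then fixed by g. *)
have wE : w = ((m%:C - 1) * ('i * c%:C))%R.
  transitivity (('i * 'i) * ((m%:C - 1) * (1 - m%:C)^-1) * w)%R.
    by rewrite -expr2 sqrCi; field.
  by rewrite cE; ring.
have FE : (fun h => h \o g) = F.
  apply/funext => h; apply/funext => z; congr h; apply: val_inj.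
  rewrite gE wE /= addr0 rmorphN/=; ring.
rewrite conj_star_translatedE /composition_max FE.
apply: (@maximal_symmetric R l F
  (fun h => shiftf c (dilation_adj m0V (shiftf (- c) h)))).
- move=> h bh; apply: bergman_shiftf; apply: bergman_dilation; exact: bergman_shiftf.
- move=> h bh; apply: bergman_shiftf; apply: bergman_dilation_adj; exact: bergman_shiftf.
- move=> h bh; apply: bergman_shiftf; apply: bergman_Kstar; exact: bergman_shiftf.
- by [].
- move=> b h k; apply/funext => z.
  by rewrite /shiftf /Kstar !conjCE rmorphD rmorphM/= mulrDr mulrCA.
- by move=> h _; rewrite shiftNfK KstarK shiftfK.
- move=> h bh; rewrite bergman_normsq_shiftf; last first.
    by apply: bergman_Kstar; exact: bergman_shiftf.
  rewrite bergman_normsq_Kstar; last exact: bergman_shiftf.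
  exact: bergman_normsq_shiftf.
- move=> h f bh bf; rewrite bergman_dot_shiftf//; last first.
    by apply: bergman_dilation; exact: bergman_shiftf.
  rewrite bergman_dot_dilation_adj; [|exact: bergman_shiftf|exact: bergman_shiftf].
  rewrite bergman_dot_shiftf ?opprK//.
  by apply: bergman_dilation_adj; exact: bergman_shiftf.
- by move=> h _; rewrite shiftNfK shiftNfK Kstar_dilation.
Qed.

End Cases.

Theorem proposition8p2 (R : realType) (l : nat) :
  [/\ forall (w0 : R[i]) (g : halfplane R -> halfplane R),
        0 <= complex.Re w0 ->
        (forall w, val (g w) = val w + w0) ->
        forall a : R, symmetric_wrt l (conj_shift l a) (composition_max l g),
      forall (mu : R) (g : halfplane R -> halfplane R),
        0 < mu ->
        (forall w, val (g w) = mu%:C * val w) ->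
        symmetric_wrt l (conj_star l) (composition_max l g) &
      forall (mu : R) (w0 : R[i]) (g : halfplane R -> halfplane R) (c : R),
        0 < mu -> mu != 1 -> complex.Re w0 = 0 ->
        (forall w, val (g w) = mu%:C * val w + w0) ->
        c%:C = 'i * (1 - mu%:C)^-1 * w0 ->
        symmetric_wrt l (conj_star_translated l c) (composition_max l g)].
Proof.
split.
- move=> w0 g w00 gE a.
  have {}gE : affine_map g 1 w0 by move=> z; rewrite gE mul1r.
  exact: translation_case w00 gE.
- by move=> mu g mu0 gE; exact: dilation_case mu0 gE.
- by move=> mu w0 g c mu0 mu1 _ gE cE; exact: affine_case mu0 mu1 gE cE.
Qed.
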